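(* Let $\{(X_n,x_n)\}_{n\in\omega}$ be a collection of path connected metrizable pointed spaces. Then $\mathfrak{h}\big(\bigvee^s_{n\in\omega}(X_n,x_n)\big)\simeq \prod_{n\in\omega}\mathfrak{h}(X_n)$.
   Context: Shrinking wedge: equip each $X_n$ with a compatible metric $d_n$ with $\mathrm{diam}(X_n)\le 2^{-n}$; $\bigvee^s_{n\in\omega}(X_n,x_n)$ is the disjoint union of the $X_n$ with all points $x_n$ identified, with metric $d(y,z)=d_n(y,z)$ if $y,z\in X_n$ and $d(y,z)=d_n(y,x_n)+d_m(z,x_m)$ if $y\in X_n\setminus\{x_n\}$, $z\in X_m\setminus\{x_m\}$, $m\ne n$ (the topology does not depend on the choices). For a path connected metric space $(X,d)$ and $x\in X$, $L_x$ is the set of loops at $x$ with metric $\sup_s d(l_0(s),l_1(s))$; a subgroup $G\le \pi_1(X,x)$ is closed if the set of loops whose classes lie in $G$ is closed in $L_x$, and $\overline{G}$ is the smallest closed subgroup containing $G$. The strong abelianization is $\mathfrak{h}(X)=\pi_1(X)/\overline{[\pi_1(X),\pi_1(X)]}$. *)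

(* Defs.v *)
From HB Require Import structures.
From mathcomp Require Import all_boot all_order all_algebra.
From mathcomp Require Import all_classical all_reals all_analysis.
Set Implicit Arguments. Unset Strict Implicit. Unset Printing Implicit Defensive.
Import Order.TTheory GRing.Theory Num.Theory.
Local Open Scope classical_set_scope.
Local Open Scope ring_scope.

Section Loops.
Variables (R : realType) (T : Type) (d : T -> T -> R) (x : T).

Definition unitI : set R := `[0, 1]%classic.

Definition cont_on_I (f : R -> T) : Prop :=
  forall s, unitI s -> forall e : R, 0 < e -> exists2 del : R, 0 < del &
    forall t, unitI t -> `|s - t| < del -> d (f s) (f t) < e.

Definition cont_on_I2 (H : R -> R -> T) : Prop :=
  forall s t, unitI s -> unitI t -> forall e : R, 0 < e -> exists2 del : R, 0 < del &
    forall s' t', unitI s' -> unitI t' -> `|s - s'| < del -> `|t - t'| < del ->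
      d (H s t) (H s' t') < e.

Definition is_path (a b : T) (f : R -> T) : Prop :=
  cont_on_I f /\ f 0 = a /\ f 1 = b.

Definition is_loop (l : R -> T) : Prop := is_path x x l.

Definition concat (l m : R -> T) : R -> T :=
  fun s => if s <= 2^-1 then l (2 * s) else m (2 * s - 1).

Definition rev (l : R -> T) : R -> T := fun s => l (1 - s).

Definition cst_loop : R -> T := fun _ => x.

Definition homotopic (l0 l1 : R -> T) : Prop :=
  exists H : R -> R -> T, cont_on_I2 H /\
    (forall s, unitI s -> H s 0 = l0 s /\ H s 1 = l1 s) /\
    (forall t, unitI t -> H 0 t = x /\ H 1 t = x).

Definition is_subgroup (S : set (R -> T)) : Prop :=
  [/\ S `<=` is_loop,
      (forall l m, S l -> is_loop m -> homotopic l m -> S m),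
      S cst_loop,
      (forall l m, S l -> S m -> S (concat l m)) &
      (forall l, S l -> S (rev l))].

Definition is_closed_loops (S : set (R -> T)) : Prop :=
  forall l, is_loop l ->
    (forall e : R, 0 < e -> exists2 m, S m & forall s, unitI s -> d (l s) (m s) < e) ->
    S l.

Definition commutator (l m : R -> T) : R -> T :=
  concat (concat l m) (concat (rev l) (rev m)).

Definition commutator_subgroup : set (R -> T) :=
  fun l => forall S, is_subgroup S ->
    (forall a b, is_loop a -> is_loop b -> S (commutator a b)) -> S l.

Definition closed_hull (G : set (R -> T)) : set (R -> T) :=
  fun l => forall S, is_subgroup S -> is_closed_loops S -> G `<=` S -> S l.

Definition h_equiv (l m : R -> T) : Prop :=
  closed_hull commutator_subgroup (concat l (rev m)).

End Loops.

Section ShrinkingWedge.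
Variables (R : realType) (X : nat -> metricType R) (x : forall n, X n).

Definition shrunk_dist (n : nat) (y z : X n) : R :=
  Num.min (mdist y z) ((2%:R : R) ^- n).

Definition wpt := {n : nat & X n}.

Definition wpt_dist (p q : wpt) : R :=
  match p, q with
  | existT n y, existT m z =>
    match @eqP nat n m with
    | ReflectT e => shrunk_dist (eq_rect n X y m e) z
    | ReflectF _ => shrunk_dist y (x n) + shrunk_dist (x m) z
    end
  end.

Definition swedge : Type := option {p : wpt | projT2 p <> x (projT1 p)}.

Definition swedge_base : swedge := None.

Definition swedge_proj (a : swedge) : wpt :=
  match a with
  | None => existT X 0%N (x 0%N)
  | Some p => sval p
  end.

Definition swedge_dist (a b : swedge) : R :=
  wpt_dist (swedge_proj a) (swedge_proj b).

End ShrinkingWedge.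

(* Main.v *)
Require Import Defs.
From HB Require Import structures.
From mathcomp Require Import all_boot all_order all_algebra ring lra.
From mathcomp Require Import all_classical all_reals all_analysis.
From Stdlib Require Setoid Morphisms.
Set Implicit Arguments. Unset Strict Implicit. Unset Printing Implicit Defensive.
Import Order.TTheory GRing.Theory Num.Theory.
Local Open Scope classical_set_scope.
Local Open Scope ring_scope.

(* The isomorphism is induced by the retractions of the wedge onto the [X n].
   For injectivity let S be a closed subgroup of loops of the wedge containing all
   commutators.  If the wedge is split into two parts A and B meeting at the base
   point, every loop u equals (its A-part)(its B-part) modulo S: this is clear for
   loops with finitely many excursions from the base point, and such loops approximate
   u uniformly, so closedness of S suffices.  Peeling off one [X n] at a time, a loop u
   whose components all lie in the closed commutator subgroups has its truncations to
   the first N summands in S; these converge uniformly to u, hence u is in S.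
   For surjectivity, loops k n in the [X n] are run through one after the other on the
   intervals [1 - 2^-n, 1 - 2^-(n+1)]; continuity in the wedge is checked componentwise. *)

(* MathComp's [rev] on sequences shadows the reversal of loops. *)
Local Notation rev := Defs.rev.

(** * Lipschitz parameter maps of the unit interval and the unit square *)

Section Lipschitz.
Variable R : realType.
Implicit Types (f g : R -> R) (s t K : R).

(** The obstacle is that a loop may change parts infinitely often, even when only two summands are
    involved, so it is not a finite word in loops of the parts and the commutators alone cannot sort
    it. Hence all algebra takes place modulo one arbitrary closed subgroup S containing the
    commutators; the closed hull is the intersection of these S. The approximating loops come from a
    sweep of the unit interval: a stretch on which u stays near the base point is replaced by the
    constant loop, a long excursion is kept unchanged, and a supremum argument shows that the sweep
    reaches 1. The part in which an excursion lies is read off from the sign of a real function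
    vanishing only at the base point, so that the intermediate value theorem applies. On the wedge
    this function is a signed distance. It is 1-Lipschitz because the wedge metric is a sum of
    component distances; for the same reason the retractions are 1-Lipschitz. *)

Lemma unitIP s : unitI s <-> 0 <= s <= 1.
Proof. by rewrite /unitI /= in_itv. Qed.

(** Required on the whole line: the maps used below are affine or clamped by [min] and [max], so no
    side condition on the arguments arises. *)
Definition lipschitz_by K f := forall s t, `|f s - f t| <= K * `|s - t|.

Definition maps_unitI f := forall s, unitI s -> unitI (f s).

Lemma lipschitz_by_weaken K K' f : K <= K' -> lipschitz_by K f -> lipschitz_by K' f.
Proof. by move=> KK' lf s t; apply: le_trans (lf s t) _; apply: ler_wpM2r. Qed.

Lemma lipschitz_by_affine a b : lipschitz_by `|a| (fun s => a * s + b).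
Proof. by move=> s t; rewrite opprD addrACA subrr addr0 -mulrBr normrM. Qed.

Lemma lipschitz_by_cst K a : 0 <= K -> lipschitz_by K (fun=> a).
Proof. by move=> K0 s t; rewrite subrr normr0 mulr_ge0. Qed.

Lemma lipschitz_by_min K f g : lipschitz_by K f -> lipschitz_by K g ->
  lipschitz_by K (fun s => Num.min (f s) (g s)).
Proof.
move=> lf lg s t; have := lf s t; have := lg s t; rewrite !ler_norml.
by case: (leP (f s)) => ?; case: (leP (f t)) => ? /andP[? ?] /andP[? ?]; apply/andP; split; lra.
Qed.

Lemma lipschitz_by_max K f g : lipschitz_by K f -> lipschitz_by K g ->
  lipschitz_by K (fun s => Num.max (f s) (g s)).
Proof.
move=> lf lg s t; have := lf s t; have := lg s t; rewrite !ler_norml.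
by case: (leP (f s)) => ?; case: (leP (f t)) => ? /andP[? ?] /andP[? ?]; apply/andP; split; lra.
Qed.

Implicit Types p : R -> R -> R.

(** Restricted to the unit square because the straight-line homotopy between two reparametrizations
    is a product in [s] and [t], in general not Lipschitz on the whole plane. *)
Definition lipschitz2_by K p := forall s t s' t',
  unitI s -> unitI t -> unitI s' -> unitI t' ->
  `|p s t - p s' t'| <= K * (`|s - s'| + `|t - t'|).

Definition maps_unitI2 p := forall s t, unitI s -> unitI t -> unitI (p s t).

Lemma lipschitz2_by_fst K f : 0 <= K -> lipschitz_by K f -> lipschitz2_by K (fun s _ => f s).
Proof.
move=> K0 lf s t s' t' _ _ _ _; apply: le_trans (lf s s') _.
by apply: ler_wpM2l => //; rewrite lerDl.
Qed.

Lemma lipschitz2_by_snd K f : 0 <= K -> lipschitz_by K f -> lipschitz2_by K (fun _ t => f t).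
Proof.
move=> K0 lf s t s' t' _ _ _ _; apply: le_trans (lf t t') _.
by apply: ler_wpM2l => //; rewrite lerDr.
Qed.

(** The radius uses [K + 1] to stay meaningful for [K = 0]; the factor 2 shares [e] between the two
    variables. *)
Lemma lipschitz2_small K p e s t s' t' : 0 <= K -> lipschitz2_by K p ->
  unitI s -> unitI t -> unitI s' -> unitI t' ->
  `|s - s'| < e / ((K + 1) * 2) -> `|t - t'| < e / ((K + 1) * 2) ->
  `|p s t - p s' t'| < e.
Proof.
move=> K0 lp Is It Is' It' hs ht.
apply: le_lt_trans (lp _ _ _ _ Is It Is' It') _.
have K1 : 0 < K + 1 by lra.
have hst : `|s - s'| + `|t - t'| < e / (K + 1).
  have -> : e / (K + 1) = e / ((K + 1) * 2) + e / ((K + 1) * 2).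
    by field; rewrite gt_eqF.
  exact: ltrD.
apply: (@le_lt_trans _ _ ((K + 1) * (`|s - s'| + `|t - t'|))).
  by rewrite mulrDl mul1r lerDl addr_ge0.
by rewrite mulrC -ltr_pdivlMr.
Qed.

Lemma lipschitz2_radius K e : 0 <= K -> 0 < e -> 0 < e / ((K + 1) * 2).
Proof. by move=> K0 e0; rewrite divr_gt0 // mulr_gt0 //; lra. Qed.

End Lipschitz.

(** * Continuity on the interval and the square: composition and gluing *)

Section Continuity.
Variables (R : realType) (T : Type) (d : T -> T -> R).
Implicit Types (f g : R -> T) (H : R -> R -> T) (p q : R -> R -> R) (K s t : R).

Lemma cont_on_I2_fst f : cont_on_I d f <-> cont_on_I2 d (fun s _ => f s).
Proof.
have I0 : unitI (0 : R) by apply/unitIP; rewrite lexx ler01.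
split=> cf.
  move=> s t Is It e /(cf s Is)[del del0 h]; exists del => // s' t' Is' It' ss' _.
  exact: h.
move=> s Is e /(cf s 0 Is I0)[del del0 h]; exists del => // t It st.
by apply: (h t 0) => //; rewrite subrr normr0.
Qed.

Lemma cont_on_I2_comp K H p q : 0 <= K -> cont_on_I2 d H ->
  lipschitz2_by K p -> lipschitz2_by K q -> maps_unitI2 p -> maps_unitI2 q ->
  cont_on_I2 d (fun s t => H (p s t) (q s t)).
Proof.
move=> K0 cH lp lq pI qI s t Is It e e0.
have [del del0 h] := cH _ _ (pI _ _ Is It) (qI _ _ Is It) _ e0.
exists (del / ((K + 1) * 2)); first exact: lipschitz2_radius.
move=> s' t' Is' It' ss' tt'.
by apply: h; [exact: pI|exact: qI|exact: (lipschitz2_small K0 lp)|exact: (lipschitz2_small K0 lq)].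
Qed.

(** Where [p] is nonzero, its Lipschitz bound keeps its sign constant nearby, so a single branch
    matters; where [p] vanishes, the branches agree and the smaller of the two radii works. *)
Lemma cont_on_I2_glue K H1 H2 p : 0 <= K -> cont_on_I2 d H1 -> cont_on_I2 d H2 ->
  lipschitz2_by K p ->
  (forall s t, unitI s -> unitI t -> p s t = 0 -> H1 s t = H2 s t) ->
  cont_on_I2 d (fun s t => if p s t <= 0 then H1 s t else H2 s t).
Proof.
move=> K0 c1 c2 lp h12 s t Is It e e0.
have [d1 d10 h1] := c1 _ _ Is It _ e0.
have [d2 d20 h2] := c2 _ _ Is It _ e0.
have [p0|p0] := eqVneq (p s t) 0.
  exists (Num.min d1 d2); first by rewrite lt_min d10.
  move=> s' t' Is' It'; rewrite !lt_min => /andP[? ?] /andP[? ?].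
  rewrite p0 lexx; case: ifP => _; first exact: h1.
  by rewrite h12 //; exact: h2.
have np0 : 0 < `|p s t| by rewrite normr_gt0.
have r0 := lipschitz2_radius K0 np0.
exists (Num.min (Num.min d1 d2) (`|p s t| / ((K + 1) * 2))); first by rewrite !lt_min d10 d20.
move=> s' t' Is' It'; rewrite !lt_min => /andP[/andP[? ?] ?] /andP[/andP[? ?] ?].
have hp : `|p s t - p s' t'| < `|p s t| by exact: (lipschitz2_small K0 lp).
have -> : (p s' t' <= 0) = (p s t <= 0).
  move: hp; have [p_le0|p_gt0] := leP (p s t) 0.
    by rewrite (ler0_norm p_le0) ltr_norml => /andP[? ?]; apply/idP; lra.
  by rewrite (gtr0_norm p_gt0) ltr_norml => /andP[? ?]; apply/negbTE; rewrite -ltNge; lra.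
by case: ifP => _; [exact: h1|exact: h2].
Qed.

Lemma cont_on_I_comp K f (g : R -> R) : 0 <= K -> cont_on_I d f -> lipschitz_by K g ->
  maps_unitI g -> cont_on_I d (f \o g).
Proof.
move=> K0 /cont_on_I2_fst cf lg gI; apply/cont_on_I2_fst.
apply: (@cont_on_I2_comp K (fun s _ => f s) (fun s _ => g s) (fun s _ => g s)) => //.
- exact: lipschitz2_by_fst.
- exact: lipschitz2_by_fst.
- by move=> s t Is _; exact: gI.
- by move=> s t Is _; exact: gI.
Qed.

Lemma cont_on_I2_eq H1 H2 : (forall s t, unitI s -> unitI t -> H1 s t = H2 s t) ->
  cont_on_I2 d H1 -> cont_on_I2 d H2.
Proof.
move=> fg cf s t Is It e /(cf s t Is It)[del del0 h]; exists del => // s' t' Is' It' ss' tt'.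
by rewrite -!fg //; exact: h.
Qed.

Lemma cont_on_I_glue c f g : cont_on_I d f -> cont_on_I d g -> f c = g c ->
  cont_on_I d (fun s => if s <= c then f s else g s).
Proof.
move=> /cont_on_I2_fst cf /cont_on_I2_fst cg fg; apply/cont_on_I2_fst.
have lp : lipschitz2_by 1 (fun s _ => s - c).
  apply: lipschitz2_by_fst => // s t.
  by rewrite mul1r opprD addrACA subrr addr0.
apply: cont_on_I2_eq (cont_on_I2_glue ler01 cf cg lp _) => s t _ _ /=.
  by rewrite subr_le0.
by move=> /eqP; rewrite subr_eq0 => /eqP ->.
Qed.

Lemma cont_on_I_cst a : d a a = 0 -> cont_on_I d (fun=> a).
Proof. by move=> daa s _ e e0; exists 1 => // t _ _; rewrite daa. Qed.

End Continuity.

(** * Homotopies of loops *)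

Section Homotopy.
Variables (R : realType) (T : Type) (d : T -> T -> R) (x : T).
Implicit Types (l m n f : R -> T) (s t K : R).

Lemma unitI0 : unitI (0 : R). Proof. by apply/unitIP; rewrite lexx ler01. Qed.

(** The affine parameters of [concat], clamped so as to map the whole interval to itself; the
    summand 0 matches the shape of [lipschitz_by_affine]. *)
Definition concat_left s : R := Num.min (2 * s + 0) 1.
Definition concat_right s : R := Num.max (2 * s + (-1)) 0.

Lemma lipschitz_concat_left : lipschitz_by 2 concat_left.
Proof.
apply: lipschitz_by_min; last exact: lipschitz_by_cst.
by rewrite -[X in lipschitz_by X](@ger0_norm R) //; exact: lipschitz_by_affine.
Qed.

Lemma lipschitz_concat_right : lipschitz_by 2 concat_right.
Proof.
apply: lipschitz_by_max; last exact: lipschitz_by_cst.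
by rewrite -[X in lipschitz_by X](@ger0_norm R) //; exact: lipschitz_by_affine.
Qed.

Lemma unitI_concat_left : maps_unitI concat_left.
Proof.
move=> s /unitIP /andP[? ?]; apply/unitIP; rewrite /concat_left.
by case: (leP (2 * s + _)) => ?; apply/andP; split; lra.
Qed.

Lemma unitI_concat_right : maps_unitI concat_right.
Proof.
move=> s /unitIP /andP[? ?]; apply/unitIP; rewrite /concat_right.
by case: (leP (2 * s + _)) => ?; apply/andP; split; lra.
Qed.

Lemma concat_leftE s : s <= 2^-1 -> concat_left s = 2 * s.
Proof. by move=> ?; rewrite /concat_left; case: leP => ?; lra. Qed.

Lemma concat_rightE s : 2^-1 <= s -> concat_right s = 2 * s - 1.
Proof. by move=> ?; rewrite /concat_right; case: leP => ?; lra. Qed.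

Lemma concatE l m s :
  concat l m s = if s <= 2^-1 then l (concat_left s) else m (concat_right s).
Proof.
by rewrite /concat; case: leP => h; rewrite ?concat_leftE ?concat_rightE // ltW.
Qed.

Lemma concatE1 l m s : s <= 2^-1 -> concat l m s = l (2 * s).
Proof. by rewrite /concat => ->. Qed.

Lemma concatE2 l m s : l 1 = m 0 -> 2^-1 <= s -> concat l m s = m (2 * s - 1).
Proof.
rewrite /concat => lm; case: (leP s) => // h1 h2.
have -> : s = 2^-1 by lra.
by rewrite divff ?pnatr_eq0 // subrr.
Qed.

Lemma is_path_concat (a0 a1 a2 : T) l m :
  is_path d a0 a1 l -> is_path d a1 a2 m -> is_path d a0 a2 (concat l m).
Proof.
move=> [cl [l0 l1]] [cm [m0 m1]]; split; last first.
  rewrite concatE1 ?invr_ge0 // mulr0 concatE2 ?l1 ?m0 //; last by lra.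
  by split=> //; rewrite (_ : 2 * 1 - 1 = 1) //; lra.
have -> : concat l m =
    fun s => if s <= 2^-1 then (l \o concat_left) s else (m \o concat_right) s.
  by apply/funext => s; exact: concatE.
apply: cont_on_I_glue.
- exact: (cont_on_I_comp _ cl lipschitz_concat_left unitI_concat_left).
- exact: (cont_on_I_comp _ cm lipschitz_concat_right unitI_concat_right).
- by rewrite /= concat_leftE // concat_rightE // divff ?pnatr_eq0 // subrr l1 m0.
Qed.

Lemma lipschitz_rev : lipschitz_by 1 (fun s : R => 1 - s).
Proof. move=> s t; rewrite mul1r distrC le_eqVlt; apply/orP; left; apply/eqP.
by congr (`|_|); ring. Qed.

Lemma unitI_rev : maps_unitI (fun s : R => 1 - s).
Proof. by move=> s /unitIP /andP[? ?]; apply/unitIP/andP; split; lra. Qed.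

Lemma is_path_rev (a0 a1 : T) l : is_path d a0 a1 l -> is_path d a1 a0 (rev l).
Proof.
move=> [cl [l0 l1]]; split; last by rewrite /rev subr0 subrr.
exact: (cont_on_I_comp _ cl lipschitz_rev unitI_rev).
Qed.

Lemma rev_concat l m : l 1 = m 0 -> rev (concat l m) = concat (rev m) (rev l).
Proof.
move=> lm; apply/funext => s; rewrite /rev; case: (leP s 2^-1) => h.
  by rewrite (concatE1 _ _ h) concatE2 //; [congr m|]; lra.
rewrite (concatE2 _ (ltW h)); last by rewrite subrr subr0.
by rewrite concatE1; [congr l|]; lra.
Qed.

Lemma rev_rev l : rev (rev l) = l.
Proof. by apply/funext => s; rewrite /rev opprB addrC subrK. Qed.

(** Loops are functions on the whole line, so equality on the interval does not give equality;
    homotopy ignores the values outside. *)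
Lemma homotopic_eqI l m : is_loop d x l -> (forall s, unitI s -> l s = m s) ->
  homotopic d x l m.
Proof.
move=> [cl [l0 l1]] lm; exists (fun s _ => l s); split; first exact/cont_on_I2_fst.
by split=> // s Is; rewrite lm.
Qed.

Lemma homotopic_sym l m : homotopic d x l m -> homotopic d x m l.
Proof.
move=> [H [cH [H01 Hx]]]; exists (fun s t => H s (1 - t)); split; last first.
  split=> [s Is|t It]; first by rewrite subr0 subrr; have [] := H01 s Is.
  exact/Hx/unitI_rev.
apply: (@cont_on_I2_comp _ _ d 1 H (fun s _ => s) (fun _ t => 1 - t)) => //.
- by apply: lipschitz2_by_fst => // s t; rewrite mul1r.
- by apply: lipschitz2_by_snd => //; exact: lipschitz_rev.
- by move=> s t _; exact: unitI_rev.
Qed.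

Lemma lipschitz2_by_id1 K : 1 <= K -> lipschitz2_by K (fun s _ : R => s).
Proof.
move=> K1; apply: lipschitz2_by_fst => [|s t]; first by lra.
by rewrite ler_peMl.
Qed.

Lemma lipschitz2_by_id2 K : 1 <= K -> lipschitz2_by K (fun _ t : R => t).
Proof.
move=> K1; apply: lipschitz2_by_snd => [|s t]; first by lra.
by rewrite ler_peMl.
Qed.

Lemma lipschitz_by_sub (c : R) : lipschitz_by 1 (fun s : R => s - c).
Proof. by move=> s t; rewrite mul1r opprD addrACA subrr addr0. Qed.

Lemma homotopic_trans l m n :
  homotopic d x l m -> homotopic d x m n -> homotopic d x l n.
Proof.
move=> [H [cH [H01 Hx]]] [G [cG [G01 Gx]]].
have I2 : (0 : R) <= 2 by [].
have I12 : (1 : R) <= 2 by rewrite ler1n.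
exists (fun s t => if t - 2^-1 <= 0 then H s (concat_left t) else G s (concat_right t)).
split; last first.
  split=> [s Is|t It].
    have := H01 _ Is; have := G01 _ Is => -[G0 G1] [H0 H1].
    rewrite !subr_le0 invr_ge0 ler0n concat_leftE ?invr_ge0 // mulr0; split=> //.
    rewrite ifF; last by apply/negbTE; rewrite -ltNge; lra.
    by rewrite concat_rightE; [rewrite -G1; congr G; lra|lra].
  have [HL0 HL1] := Hx _ (unitI_concat_left It).
  have [GR0 GR1] := Gx _ (unitI_concat_right It).
  by case: ifP.
apply: (@cont_on_I2_glue _ _ d 1 _ _ (fun _ t => t - 2^-1)) => //.
- apply: (@cont_on_I2_comp _ _ d 2 H (fun s _ => s) (fun _ => concat_left)) => //.
  + exact: lipschitz2_by_id1.
  + exact/lipschitz2_by_snd/lipschitz_concat_left.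
  + by move=> s t _; exact: unitI_concat_left.
- apply: (@cont_on_I2_comp _ _ d 2 G (fun s _ => s) (fun _ => concat_right)) => //.
  + exact: lipschitz2_by_id1.
  + exact/lipschitz2_by_snd/lipschitz_concat_right.
  + by move=> s t _; exact: unitI_concat_right.
- exact/lipschitz2_by_snd/lipschitz_by_sub.
- move=> s t Is It /eqP; rewrite subr_eq0 => /eqP ->.
  rewrite concat_leftE // concat_rightE // divff ?pnatr_eq0 // subrr.
  by have [-> _] := G01 s Is; have [_ ->] := H01 s Is.
Qed.

Lemma homotopic_concat l l' m m' : homotopic d x l l' -> homotopic d x m m' ->
  homotopic d x (concat l m) (concat l' m').
Proof.
move=> [H [cH [H01 Hx]]] [G [cG [G01 Gx]]].
have I12 : (1 : R) <= 2 by rewrite ler1n.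
exists (fun s t => if s - 2^-1 <= 0 then H (concat_left s) t else G (concat_right s) t).
split; last first.
  split=> [s Is|t It].
    rewrite subr_le0 !concatE.
    have := H01 _ (unitI_concat_left Is); have := G01 _ (unitI_concat_right Is).
    by case: ifP.
  rewrite !subr_le0 invr_ge0 ler0n concat_leftE ?invr_ge0 // mulr0.
  rewrite ifF; last by apply/negbTE; rewrite -ltNge; lra.
  rewrite concat_rightE; last by lra.
  have -> : 2 * 1 - 1 = 1 :> R by lra.
  by have [-> _] := Hx _ It; have [_ ->] := Gx _ It.
apply: (@cont_on_I2_glue _ _ d 1 _ _ (fun s _ => s - 2^-1)) => //.
- apply: (@cont_on_I2_comp _ _ d 2 H (fun s _ => concat_left s) (fun _ t => t)) => //.
  + exact/lipschitz2_by_fst/lipschitz_concat_left.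
  + exact: lipschitz2_by_id2.
  + by move=> s t Is _; exact: unitI_concat_left.
- apply: (@cont_on_I2_comp _ _ d 2 G (fun s _ => concat_right s) (fun _ t => t)) => //.
  + exact/lipschitz2_by_fst/lipschitz_concat_right.
  + exact: lipschitz2_by_id2.
  + by move=> s t Is _; exact: unitI_concat_right.
- exact/lipschitz2_by_fst/lipschitz_by_sub.
- move=> s t Is It /eqP; rewrite subr_eq0 => /eqP ->.
  rewrite concat_leftE // concat_rightE // divff ?pnatr_eq0 // subrr.
  by have [-> _] := Gx t It; have [_ ->] := Hx t It.
Qed.

Lemma homotopic_rev l m : homotopic d x l m -> homotopic d x (rev l) (rev m).
Proof.
move=> [H [cH [H01 Hx]]]; exists (fun s t => H (1 - s) t); split; last first.
  split=> [s Is|t It]; first exact/H01/unitI_rev.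
  by rewrite subr0 subrr; have [] := Hx t It.
apply: (@cont_on_I2_comp _ _ d 1 H (fun s _ => 1 - s) (fun _ t => t)) => //.
- by apply: lipschitz2_by_fst => //; exact: lipschitz_rev.
- by apply: lipschitz2_by_snd => // s t; rewrite mul1r.
- by move=> s t Is _; exact: unitI_rev.
Qed.

(* The straight-line homotopy in the parameter interval. *)
Lemma homotopic_reparam K f (phi psi : R -> R) : 0 <= K -> cont_on_I d f ->
  lipschitz_by K phi -> lipschitz_by K psi -> maps_unitI phi -> maps_unitI psi ->
  phi 0 = psi 0 -> phi 1 = psi 1 -> f (phi 0) = x -> f (phi 1) = x ->
  homotopic d x (f \o phi) (f \o psi).
Proof.
move=> K0 /cont_on_I2_fst cf lphi lpsi Iphi Ipsi e0 e1 f0 f1.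
pose p s t := (1 - t) * phi s + t * psi s.
exists (fun s t => f (p s t)); split; last first.
  split=> [s _|t _]; first by rewrite /p /= subr0 subrr !mul0r !mul1r addr0 add0r.
  by rewrite /p -e0 -e1 -!mulrDl subrK !mul1r.
have K1 : 0 <= K + 1 by lra.
have Ip : maps_unitI2 p.
  move=> s t Is /unitIP /andP[t0 t1].
  have /unitIP /andP[a0 a1] := Iphi _ Is; have /unitIP /andP[b0 b1] := Ipsi _ Is.
  by apply/unitIP; rewrite /p; apply/andP; split; nra.
suff lp : lipschitz2_by (K + 1) p.
  by apply: (@cont_on_I2_comp _ _ d (K + 1) (fun s _ => f s) p p).
move=> s t s' t' Is /unitIP /andP[t0 t1] Is' It'.
have /unitIP /andP[a0 a1] := Iphi _ Is'; have /unitIP /andP[b0 b1] := Ipsi _ Is'.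
(* The first summand moves [s] at fixed [t] and costs [K]; the second moves [t] and costs 1, since
   [phi] and [psi] take values in the unit interval. *)
have -> : p s t - p s' t' =
    ((1 - t) * (phi s - phi s') + t * (psi s - psi s')) + (t' - t) * (phi s' - psi s').
  by rewrite /p; ring.
apply: le_trans (ler_normD _ _) _.
have h1 : `|(1 - t) * (phi s - phi s') + t * (psi s - psi s')| <= K * `|s - s'|.
  apply: le_trans (ler_normD _ _) _; rewrite !normrM.
  rewrite (ger0_norm t0) (@ger0_norm _ (1 - t)); last by lra.
  by have := lphi s s'; have := lpsi s s'; nra.
have h2 : `|(t' - t) * (phi s' - psi s')| <= `|t - t'|.
  rewrite normrM distrC ler_piMr // ler_norml; apply/andP; split; lra.
apply: le_trans (lerD h1 h2) _.
have := normr_ge0 (s - s'); have := normr_ge0 (t - t').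
by nra.
Qed.

Hypothesis d_refl : d x x = 0.

(** Bundling makes the group operations total, so that the group laws allow setoid rewriting up to
    homotopy. *)
Record loop := Loop { loop_fun :> R -> T; loopP : is_loop d x loop_fun }.

Definition lcat (a b : loop) : loop := Loop (is_path_concat (loopP a) (loopP b)).
Definition lrev (a : loop) : loop := Loop (is_path_rev (loopP a)).

Lemma is_loop_cst : is_loop d x (cst_loop x).
Proof. by split=> //; exact: cont_on_I_cst. Qed.

Definition lone : loop := Loop is_loop_cst.

Definition lhom (a b : loop) : Prop := homotopic d x a b.

End Homotopy.

(** * The loop group and subgroups containing the commutators *)

Section LoopGroup.
Variables (R : realType) (T : Type) (d : T -> T -> R) (x : T).
Hypothesis d_refl : d x x = 0.

Local Notation loop := (loop d x).
Local Notation lone := (lone d_refl).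
Implicit Types a b c : loop.

Lemma lhom_refl a : lhom a a.
Proof. exact: (homotopic_eqI (loopP a)). Qed.
#[local] Hint Resolve lhom_refl : core.

Lemma lhom_sym a b : lhom a b -> lhom b a.
Proof. exact: homotopic_sym. Qed.

Lemma lhom_trans a b c : lhom a b -> lhom b c -> lhom a c.
Proof. exact: homotopic_trans. Qed.

#[local] Instance lhom_equivalence : RelationClasses.Equivalence (@lhom R T d x).
Proof. by split; [exact: lhom_refl|exact: lhom_sym|exact: lhom_trans]. Qed.

#[local] Instance lcat_lhom :
  Morphisms.Proper (Morphisms.respectful (@lhom R T d x)
    (Morphisms.respectful (@lhom R T d x) (@lhom R T d x))) (@lcat R T d x).
Proof. by move=> a a' aa' b b' bb'; exact: homotopic_concat. Qed.

#[local] Instance lrev_lhom :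
  Morphisms.Proper (Morphisms.respectful (@lhom R T d x) (@lhom R T d x)) (@lrev R T d x).
Proof. by move=> a a' aa'; exact: homotopic_rev. Qed.

Lemma lipschitz_by_id : lipschitz_by 1 (@id R).
Proof. by move=> s t; rewrite mul1r. Qed.

Lemma loop0 a : a 0 = x. Proof. by have [_ []] := loopP a. Qed.
Lemma loop1 a : a 1 = x. Proof. by have [_ []] := loopP a. Qed.
Lemma loop_cont a : cont_on_I d a. Proof. by have [] := loopP a. Qed.

Lemma lcat1 a : lhom (lcat a lone) a.
Proof.
rewrite /lhom /lcat /=.
have -> : concat a (cst_loop x) = a \o concat_left (R := R).
  apply/funext => s /=; rewrite concatE; case: (leP s 2^-1) => // h.
  have -> : concat_left s = 1 by rewrite /concat_left; case: leP => ?; lra.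
  by rewrite loop1.
apply: (@homotopic_reparam _ _ d x 2 a _ id) => //.
- exact: loop_cont.
- exact: lipschitz_concat_left.
- by apply: lipschitz_by_weaken lipschitz_by_id; rewrite ler1n.
- exact: unitI_concat_left.
- by rewrite /concat_left; case: leP => ?; lra.
- by rewrite /concat_left; case: leP => ?; lra.
- by rewrite concat_leftE ?invr_ge0 // mulr0 loop0.
- rewrite (_ : concat_left 1 = 1) ?loop1 // /concat_left; case: leP => ?; lra.
Qed.

Lemma lcat1l a : lhom (lcat lone a) a.
Proof.
rewrite /lhom /lcat /=.
have -> : concat (cst_loop x) a = a \o concat_right (R := R).
  apply/funext => s /=; rewrite concatE; case: (leP s 2^-1) => // h.
  have -> : concat_right s = 0 by rewrite /concat_right; case: leP => ?; lra.
  by rewrite loop0.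
apply: (@homotopic_reparam _ _ d x 2 a _ id) => //.
- exact: loop_cont.
- exact: lipschitz_concat_right.
- by apply: lipschitz_by_weaken lipschitz_by_id; rewrite ler1n.
- exact: unitI_concat_right.
- by rewrite /concat_right; case: leP => ?; lra.
- by rewrite /concat_right; case: leP => ?; lra.
- rewrite (_ : concat_right 0 = 0) ?loop0 // /concat_right; case: leP => ?; lra.
- rewrite (_ : concat_right 1 = 1) ?loop1 // /concat_right; case: leP => ?; lra.
Qed.

(** The tent function [phi] runs from 0 up to 1 and back; both loops are [a] precomposed with a map
    vanishing at 0 and 1. *)
Lemma lcatV a : lhom (lcat a (lrev a)) lone.
Proof.
rewrite /lhom /lcat /=.
pose phi (s : R) := Num.min (2 * s + 0) (-2 * s + 2).
have -> : cst_loop x = a \o (fun _ : R => 0) by apply/funext => s /=; rewrite loop0.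
apply: (@homotopic_trans _ _ d x _ (a \o phi)).
  apply: homotopic_eqI; first exact: loopP (lcat a (lrev a)).
  move=> s _ /=; rewrite /phi.
  case: (leP s 2^-1) => h.
    by rewrite concatE1 //; congr (loop_fun a _); case: leP => ?; lra.
  rewrite concatE2; [|by rewrite /rev subr0|exact: ltW].
  by rewrite /rev; congr (loop_fun a _); case: leP => ?; lra.
apply: (@homotopic_reparam _ _ d x 2 a) => //.
- exact: loop_cont.
- apply: lipschitz_by_min.
    by rewrite -[X in lipschitz_by X](@ger0_norm R) //; exact: lipschitz_by_affine.
  by rewrite -[X in lipschitz_by X](@ger0_norm R) // -normrN; exact: lipschitz_by_affine.
- exact: lipschitz_by_cst.
- move=> s /unitIP /andP[s0 s1]; apply/unitIP; rewrite /phi.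
  by case: (leP (2 * s + 0)) => ?; apply/andP; split; lra.
- by move=> s _; exact: unitI0.
- by rewrite /phi; case: leP => ?; lra.
- by rewrite /phi; case: leP => ?; lra.
- rewrite (_ : phi 0 = 0) ?loop0 // /phi; case: leP => ?; lra.
- rewrite (_ : phi 1 = 0) ?loop0 // /phi; case: leP => ?; lra.
Qed.

Lemma lrevK a : lhom (lrev (lrev a)) a.
Proof. by rewrite /lhom /= rev_rev; exact: lhom_refl. Qed.

Lemma lcatVl a : lhom (lcat (lrev a) a) lone.
Proof. by rewrite -{2}(lrevK a); exact: lcatV. Qed.

Lemma lrev_cat a b : lhom (lrev (lcat a b)) (lcat (lrev b) (lrev a)).
Proof.
rewrite /lhom /= rev_concat ?loop0 ?loop1 //.
exact: (lhom_refl (lcat (lrev b) (lrev a))).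
Qed.

(** The change of parameter sends 1/4 to 1/2 and 1/2 to 3/4. Its slopes 2, 1, 1/2 decrease, so [phi]
    is the minimum of its three affine pieces. *)
Lemma lcatA a b c : lhom (lcat (lcat a b) c) (lcat a (lcat b c)).
Proof.
rewrite /lhom /=.
pose phi (s : R) := Num.min (2 * s + 0) (Num.min (1 * s + 4^-1) (2^-1 * s + 2^-1)).
pose f := lcat a (lcat b c).
have bc0 : concat b c 0 = x by exact: (loop0 (lcat b c)).
apply: (@homotopic_trans _ _ d x _ (f \o phi)).
  apply: homotopic_eqI; first exact: loopP (lcat (lcat a b) c).
  move=> s _; rewrite /f /=; case: (leP s 2^-1) => h.
    rewrite concatE1 //; case: (leP s 4^-1) => h4.
      have -> : phi s = 2 * s.
        by rewrite /phi; case: (leP (1 * s + _)) => ?; case: leP => ?; lra.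
      by rewrite !concatE1 //; lra.
    have -> : phi s = s + 4^-1.
      by rewrite /phi; case: (leP (1 * s + _)) => ?; case: leP => ?; lra.
    rewrite concatE2 ?loop0 ?loop1 //; last lra.
    rewrite concatE2 ?bc0 ?loop1 //; last lra.
    by rewrite concatE1 //; [congr (loop_fun b _)|]; lra.
  have -> : phi s = 2^-1 * s + 2^-1.
    by rewrite /phi; case: (leP (1 * s + _)) => ?; case: leP => ?; lra.
  rewrite concatE2 ?loop0 //; [|exact: (loop1 (lcat a b))|exact: ltW].
  rewrite concatE2 ?bc0 ?loop1 //; last lra.
  by rewrite concatE2 ?loop0 ?loop1 //; [congr (loop_fun c _)|]; lra.
have -> : concat a (concat b c) = f \o id by [].
have p0 : phi 0 = 0 by rewrite /phi; case: (leP (1 * 0 + _)) => ?; case: leP => ?; lra.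
have p1 : phi 1 = 1 by rewrite /phi; case: (leP (1 * 1 + _)) => ?; case: leP => ?; lra.
apply: (@homotopic_reparam _ _ d x 2 f) => //.
- exact: loop_cont.
- apply: lipschitz_by_min.
    by rewrite -[X in lipschitz_by X](@ger0_norm R) //; exact: lipschitz_by_affine.
  apply: lipschitz_by_min; apply: (lipschitz_by_weaken _ (lipschitz_by_affine _ _)).
    by rewrite normr1 ler1n.
  by rewrite ger0_norm ?invr_ge0 //; lra.
- by apply: lipschitz_by_weaken lipschitz_by_id; rewrite ler1n.
- move=> s /unitIP /andP[s0 s1]; apply/unitIP; rewrite /phi.
  by case: (leP (1 * s + _)) => ?; case: (leP (2 * s + _)) => ?; apply/andP; split; lra.
- by rewrite p0 loop0.
- by rewrite p1 loop1.
Qed.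

Lemma lcatKl a b : lhom (lcat (lrev a) (lcat a b)) b.
Proof. by rewrite -lcatA lcatVl lcat1l. Qed.

(** * Congruence modulo a subgroup containing all commutators *)

Section Modulo.
Variable S : set (R -> T).
Hypothesis S_subgroup : is_subgroup d x S.
Hypothesis S_commutator : forall l m, is_loop d x l -> is_loop d x m -> S (commutator l m).

Let inS (a : loop) : Prop := S a.

#[local] Instance inS_lhom : Morphisms.Proper
  (Morphisms.respectful (@lhom R T d x) iff) inS.
Proof.
have [_ Sh _ _ _] := S_subgroup.
by move=> a b ab; split=> [Sa|Sb]; [apply: (Sh a)|apply: (Sh b)] => //;
  [exact: loopP|exact: loopP|exact: lhom_sym].
Qed.

Lemma inS_cat a b : inS a -> inS b -> inS (lcat a b).
Proof. by have [_ _ _ Sc _] := S_subgroup; exact: Sc. Qed.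

Lemma inS_rev a : inS a -> inS (lrev a).
Proof. by have [_ _ _ _ Sr] := S_subgroup; exact: Sr. Qed.

Lemma inS_one : inS lone.
Proof. by have [] := S_subgroup. Qed.

(** Such a subgroup is normal: the conjugate of b by a is [a, b] times b. *)
Lemma inS_conj a b : inS b -> inS (lcat a (lcat b (lrev a))).
Proof.
move=> Sb; have := S_commutator (loopP a) (loopP b).
rewrite -/(inS (lcat (lcat a b) (lcat (lrev a) (lrev b)))) => Sab.
have := inS_cat Sab Sb.
by rewrite !lcatA lcatVl lcat1.
Qed.

Definition modS (a b : loop) : Prop := S (lcat a (lrev b)).

Lemma lhom_modS a b : lhom a b -> modS a b.
Proof. by move=> ab; rewrite /modS -/(inS (lcat a (lrev b))) ab lcatV; exact: inS_one. Qed.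

Lemma modS_refl a : modS a a.
Proof. exact/lhom_modS/lhom_refl. Qed.

Lemma modS_sym a b : modS a b -> modS b a.
Proof.
move=> ab; have := inS_rev ab; rewrite lrev_cat lrevK; exact.
Qed.

Lemma modS_trans a b c : modS a b -> modS b c -> modS a c.
Proof.
move=> ab bc; have := inS_cat ab bc; rewrite lcatA lcatKl; exact.
Qed.

(** The quotient of the two products is the conjugate of b b'^-1 by a, times a a'^-1. *)
Lemma modS_cat a a' b b' : modS a a' -> modS b b' -> modS (lcat a b) (lcat a' b').
Proof.
move=> aa' bb'; have := inS_cat (inS_conj a bb') aa'.
rewrite /modS -/(inS (lcat (lcat a b) (lrev (lcat a' b')))) lrev_cat !lcatA lcatKl; exact.
Qed.

Lemma modS_comm a b : modS (lcat a b) (lcat b a).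
Proof.
rewrite /modS -/(inS (lcat (lcat a b) (lrev (lcat b a)))) lrev_cat.
exact: S_commutator (loopP a) (loopP b).
Qed.

Lemma modS_catACA a b a' b' :
  modS (lcat (lcat a b) (lcat a' b')) (lcat (lcat a a') (lcat b b')).
Proof.
apply: modS_trans (lhom_modS (lcatA _ _ _)) _.
apply: modS_sym; apply: modS_trans (lhom_modS (lcatA _ _ _)) _.
apply: modS_cat; first exact: modS_refl.
apply: modS_trans (modS_sym (lhom_modS (lcatA _ _ _))) _.
apply: modS_sym; apply: modS_trans (modS_sym (lhom_modS (lcatA _ _ _))) _.
by apply: modS_cat; [exact: modS_comm|exact: modS_refl].
Qed.

Lemma inS_modS a b : modS a b -> S b -> S a.
Proof. by move=> ab Sb; have := inS_cat ab Sb; rewrite lcatA lcatVl lcat1; exact. Qed.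

End Modulo.

(** A subgroup contains the commutator subgroup as soon as it contains the commutators, so the two
    nested intersections collapse to one, and membership is tested on one closed subgroup at a
    time. *)
Lemma closed_hull_commutatorP l :
  closed_hull d x (commutator_subgroup d x) l <->
  forall S, is_subgroup d x S -> is_closed_loops d x S ->
    (forall m n, is_loop d x m -> is_loop d x n -> S (commutator m n)) -> S l.
Proof.
split=> [hl S Ss Sc Scom|hl S Ss Sc Scom].
  by apply: hl => // m cm; exact: cm.
by apply: hl => // m n lm ln; apply: Scom => S' _ S'com; exact: S'com.
Qed.

Lemma h_equiv_refl a : h_equiv d x a a.
Proof.
apply/closed_hull_commutatorP => S Ss _ _.
exact: (modS_refl Ss a).
Qed.

Lemma lhom_h_equiv a b : lhom a b -> h_equiv d x a b.
Proof.
move=> ab; apply/closed_hull_commutatorP => S Ss _ _.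
exact: (lhom_modS Ss ab).
Qed.

End LoopGroup.

(** * Action of uniformly continuous pointed maps on loops and closed subgroups *)

Section Pushforward.
Variables (R : realType) (T T' : Type) (d : T -> T -> R) (d' : T' -> T' -> R).
Variables (x : T) (x' : T') (F : T -> T').
Implicit Types l m : R -> T.

(** A modulus independent of the point turns uniformly close loops into uniformly close loops, which
    is what pulling back closed sets of loops uses. *)
Definition uniformly_continuous := forall e : R, 0 < e -> exists2 del : R, 0 < del &
  forall y z, d y z < del -> d' (F y) (F z) < e.

Hypothesis F_cont : uniformly_continuous.
Hypothesis F_base : F x = x'.

Lemma is_loop_push l : is_loop d x l -> is_loop d' x' (F \o l).
Proof.
move=> [cl [l0 l1]]; split; last by rewrite /= l0 l1.
move=> s Is e /F_cont[del del0 hF]; have [del' del'0 h] := cl s Is _ del0.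
by exists del' => // t It st; apply/hF/h.
Qed.

Lemma homotopic_push l m : homotopic d x l m -> homotopic d' x' (F \o l) (F \o m).
Proof.
move=> [H [cH [H01 Hx]]]; exists (fun s t => F (H s t)); split; last first.
  split=> [s Is|t It] /=.
    by have [-> ->] := H01 _ Is.
  by have [-> ->] := Hx _ It; rewrite F_base.
move=> s t Is It e /F_cont[del del0 hF]; have [del' del'0 h] := cH s t Is It _ del0.
by exists del' => // s' t' Is' It' ss' tt'; apply/hF/h.
Qed.

Lemma push_concat l m : F \o concat l m = concat (F \o l) (F \o m).
Proof. by apply/funext => s; rewrite /concat /=; case: ifP. Qed.

Lemma is_subgroup_pull S : d' x' x' = 0 -> d x x = 0 -> is_subgroup d' x' S ->
  is_subgroup d x [set l | is_loop d x l /\ S (F \o l)].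
Proof.
move=> d'0 d0 [Sl Sh S1 Sc Sr]; split.
- by move=> l [].
- move=> l m [ll Sl'] lm hlm; split=> //.
  by apply: Sh Sl' _ _; [exact: is_loop_push|exact: homotopic_push].
- split; first exact: is_loop_cst.
  by rewrite (_ : F \o _ = cst_loop x') //; apply/funext => s /=; rewrite F_base.
- move=> l m [ll Sl'] [lm Sm']; split; first exact: is_path_concat ll lm.
  by rewrite push_concat; exact: Sc.
- move=> l [ll Sl']; split; first exact: is_path_rev.
  exact: Sr Sl'.
Qed.

Lemma is_closed_loops_pull S : is_closed_loops d' x' S ->
  is_closed_loops d x [set l | is_loop d x l /\ S (F \o l)].
Proof.
move=> Scl l ll h; split=> //; apply: Scl; first exact: is_loop_push.
move=> e /F_cont[del del0 hF]; have [m [lm Sm] hm] := h _ del0.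
by exists (F \o m) => // s Is; apply/hF/hm.
Qed.

(** The preimage under [F] of a closed subgroup containing the commutators is again one. *)
Lemma closed_hull_push l : d' x' x' = 0 -> d x x = 0 ->
  closed_hull d x (commutator_subgroup d x) l ->
  closed_hull d' x' (commutator_subgroup d' x') (F \o l).
Proof.
move=> d'0 d0 /(closed_hull_commutatorP d) hl.
apply/closed_hull_commutatorP => S Ss Sc Scom.
have [] // := hl _ (is_subgroup_pull d'0 d0 Ss) (is_closed_loops_pull Sc).
move=> a b la lb; split.
  have lab := is_path_concat la lb.
  exact: is_path_concat lab (is_path_concat (is_path_rev la) (is_path_rev lb)).
rewrite /commutator !push_concat.
exact: Scom (is_loop_push la) (is_loop_push lb).
Qed.

End Pushforward.

(** * Splitting a loop along two complementary retractions *)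

Section Splitting.
Import numFieldNormedType.Exports.
Variables (R : realType) (T : Type) (d : T -> T -> R) (x : T).
Hypothesis d_refl : forall y, d y y = 0.
Hypothesis d_sym : forall y z, d y z = d z y.

Local Notation loop := (loop d x).

Definition glue (c : R) (f g : R -> T) : R -> T := fun s => if s <= c then f s else g s.

Section Glue.
Variables (c : R) (f g : loop).
Hypothesis Ic : unitI c.
Hypothesis f_base : forall s, unitI s -> c <= s -> f s = x.
Hypothesis g_base : forall s, unitI s -> s <= c -> g s = x.

Lemma is_loop_glue : is_loop d x (glue c f g).
Proof.
have /unitIP /andP[c0 c1] := Ic.
split; first by apply: cont_on_I_glue; [exact: loop_cont|exact: loop_cont|rewrite f_base ?g_base].
split; first by rewrite /glue c0 loop0.
by rewrite /glue; case: ifP; rewrite loop1.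
Qed.

(** On the interval [concat f g] is the glued loop precomposed with [phi], which moves at double
    speed but waits at [c] while [f] has already returned to [x] and [g] has not yet left. *)
Lemma homotopic_glue : homotopic d x (glue c f g) (concat f g).
Proof.
have /unitIP /andP[c0 c1] := Ic.
pose phi (s : R) := Num.max (Num.min (2 * s + 0) c) (2 * s + (-1)).
apply: homotopic_sym; apply: (@homotopic_trans _ _ d x _ (glue c f g \o phi)).
  apply: homotopic_eqI; first exact: loopP (lcat f g).
  move=> s /unitIP /andP[s0 s1]; rewrite /= /glue; case: (leP s 2^-1) => h.
    rewrite concatE1 //.
    have -> : phi s = Num.min (2 * s) c.
      by rewrite /phi addr0; case: (leP (2 * s) c) => ?; case: leP => ?; lra.
    case: (leP (2 * s) c) => hc; first by rewrite hc.
    by rewrite lexx !f_base //; [apply/unitIP/andP; split; lra|exact: ltW].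
  rewrite concatE2 ?loop0 ?loop1 //; last exact: ltW.
  have -> : phi s = Num.max c (2 * s - 1).
    by rewrite /phi; case: (leP (2 * s + 0) c) => // ?; case: leP => ?; case: leP => ?; lra.
  case: (leP c (2 * s - 1)) => hc.
    case: ifP => // hc'; rewrite f_base ?g_base //; apply/unitIP/andP; split; lra.
  by rewrite lexx f_base ?g_base //; [apply/unitIP/andP; split; lra|exact: ltW].
have -> : glue c f g = glue c f g \o id by [].
have [cglue [glue0 glue1]] := is_loop_glue.
have p0 : phi 0 = 0 by rewrite /phi; case: (leP (2 * 0 + 0)) => ?; case: leP => ?; lra.
have p1 : phi 1 = 1 by rewrite /phi; case: (leP (2 * 1 + 0)) => ?; case: leP => ?; lra.
have lip2 : forall b : R, lipschitz_by 2 (fun s => 2 * s + b).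
  by move=> b; rewrite -[X in lipschitz_by X](@ger0_norm R) //; exact: lipschitz_by_affine.
apply: (@homotopic_reparam _ _ d x 2 (glue c f g \o id)) => //.
- apply: lipschitz_by_max => //; apply: lipschitz_by_min => //; exact: lipschitz_by_cst.
- by apply: lipschitz_by_weaken (@lipschitz_by_id R); rewrite ler1n.
- move=> s /unitIP /andP[s0 s1]; apply/unitIP; rewrite /phi.
  by case: (leP (2 * s + 0)) => ?; case: (leP _ (2 * s + _)) => ?; apply/andP; split; lra.
- by rewrite p0.
- by rewrite p1.
Qed.

End Glue.

Lemma concat_close (e : R) (l m l' m' : R -> T) :
  (forall s, unitI s -> d (l s) (l' s) < e) -> (forall s, unitI s -> d (m s) (m' s) < e) ->
  forall s, unitI s -> d (concat l m s) (concat l' m' s) < e.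
Proof.
move=> hl hm s Is; rewrite !concatE; case: ifP => _.
  exact/hl/unitI_concat_left.
exact/hm/unitI_concat_right.
Qed.

Variables (S : set (R -> T)) (rA rB : T -> T).
Hypothesis S_subgroup : is_subgroup d x S.
Hypothesis S_commutator : forall l m, is_loop d x l -> is_loop d x m -> S (commutator l m).
Hypothesis rA_cont : uniformly_continuous d d rA.
Hypothesis rB_cont : uniformly_continuous d d rB.
Hypothesis rA_base : rA x = x.
Hypothesis rB_base : rB x = x.

Local Notation lone := (lone (d_refl x)).
Let pA (a : loop) : loop := Loop (is_loop_push rA_cont rA_base (loopP a)).
Let pB (a : loop) : loop := Loop (is_loop_push rB_cont rB_base (loopP a)).

Let splits (a : loop) := modS S a (lcat (pA a) (pB a)).

(** In the abelian quotient the two A-parts can be brought together, and likewise the B-parts. The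
    loop [h] is only homotopic to a concatenation because the lemma serves for glued loops. *)
Lemma splits_cat (a b h : loop) : lhom h (lcat a b) -> splits a -> splits b -> splits h.
Proof.
move=> hab sa sb; rewrite /splits.
have trans := modS_trans (d_refl x) S_subgroup.
have hom := lhom_modS (d_refl x) S_subgroup.
have hA : lhom (pA h) (lcat (pA a) (pA b)).
  by have := homotopic_push rA_cont rA_base hab; rewrite /= push_concat.
have hB : lhom (pB h) (lcat (pB a) (pB b)).
  by have := homotopic_push rB_cont rB_base hab; rewrite /= push_concat.
apply: (trans _ _ _ (hom _ _ hab)).
apply: (trans _ _ _ (modS_cat (d_refl x) S_subgroup S_commutator sa sb)).
apply: (trans _ _ _ (modS_catACA (d_refl x) S_subgroup S_commutator _ _ _ _)).
apply: (modS_sym S_subgroup).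
by apply: (modS_cat (d_refl x) S_subgroup S_commutator); exact: hom.
Qed.

Lemma splits_left (a : loop) : (forall s, rA (a s) = a s /\ rB (a s) = x) -> splits a.
Proof.
move=> h; rewrite /splits; apply: (lhom_modS (d_refl x)) => //.
have := lhom_sym (lcat1 (d_refl x) a).
rewrite /lhom /= (_ : rA \o a = a) 1?(_ : rB \o a = cst_loop x) //;
  by apply/funext => s /=; have [] := h s.
Qed.

Lemma splits_right (a : loop) : (forall s, rB (a s) = a s /\ rA (a s) = x) -> splits a.
Proof.
move=> h; rewrite /splits; apply: (lhom_modS (d_refl x)) => //.
have := lhom_sym (lcat1l (d_refl x) a).
rewrite /lhom /= (_ : rB \o a = a) 1?(_ : rA \o a = cst_loop x) //;
  by apply/funext => s /=; have [] := h s.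
Qed.

(** A signed distance to the base point: nonnegative values mark the first part, nonpositive ones
    the second. *)
Variable g : T -> R.
Hypothesis g_lip : forall y z, `|g y - g z| <= d y z.
Hypothesis g_base : g x = 0.
Hypothesis g_ge0 : forall y, 0 <= g y -> rA y = y /\ rB y = x.
Hypothesis g_le0 : forall y, g y <= 0 -> rB y = y /\ rA y = x.

Variable u : loop.

Lemma g_zero y : g y = 0 -> y = x.
Proof.
move=> gy; have [<- _] : rA y = y /\ rB y = x by apply: g_ge0; rewrite gy.
by have [_ ->] : rB y = y /\ rA y = x by apply: g_le0; rewrite gy.
Qed.

(** By [g_lip] the value of [g] at [u r] is at most any positive [e] in absolute value, and [g]
    vanishes only at [x]. *)
Lemma base_adherent r : unitI r ->
  (forall e : R, 0 < e -> exists2 z, unitI z /\ u z = x & `|r - z| < e) -> u r = x.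
Proof.
move=> Ir h; apply: g_zero; apply/eqP; rewrite -normr_eq0; apply/eqP.
apply/le_anti; rewrite normr_ge0 andbT; apply/ler_addgt0Pr => e e0; rewrite add0r.
have [del del0 hdel] := loop_cont u Ir e0.
have [z [Iz uz] rz] := h _ del0.
have := g_lip (u r) (u z); rewrite uz g_base subr0 => /le_trans; apply.
by have := hdel z Iz rz; rewrite uz => /ltW.
Qed.

Lemma base_sup (A : set R) : A !=set0 -> (forall z, A z -> unitI z /\ u z = x) ->
  unitI (sup A) /\ u (sup A) = x.
Proof.
move=> [z Az] hA.
have supA : has_sup A.
  by split; [exists z|exists 1 => w /hA[/unitIP /andP[]]].
have Isup : unitI (sup A).
  have [/unitIP /andP[z0 z1] _] := hA _ Az.
  apply/unitIP/andP; split.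
    by apply: le_trans z0 _; apply: ub_le_sup => //; case: supA.
  by apply: ge_sup => [|w /hA[/unitIP /andP[]]] //; exists z.
split=> //; apply: base_adherent => // e e0.
have [w Aw hw] := sup_adherent e0 supA.
exists w; first exact: hA.
rewrite ger0_norm; first by lra.
by rewrite subr_ge0; apply: ub_le_sup => //; case: supA.
Qed.

Lemma base_inf (A : set R) : A !=set0 -> (forall z, A z -> unitI z /\ u z = x) ->
  unitI (inf A) /\ u (inf A) = x.
Proof.
move=> [z Az] hA.
have infA : has_inf A.
  by split; [exists z|exists 0 => w /hA[/unitIP /andP[]]].
have Iinf : unitI (inf A).
  have [/unitIP /andP[z0 z1] _] := hA _ Az.
  apply/unitIP/andP; split.
    by apply: lb_le_inf => [|w /hA[/unitIP /andP[]]] //; exists z.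
  by apply: le_trans z1; apply: ge_inf => //; case: infA.
split=> //; apply: base_adherent => // e e0.
have [w Aw hw] := inf_adherent e0 infA.
exists w; first exact: hA.
rewrite ler0_norm; first by lra.
by rewrite subr_le0; apply: ge_inf => //; case: infA.
Qed.

(* By the intermediate value theorem, [u] cannot pass from one part to the other
   without visiting the base point. *)
Lemma base_between (s t : R) : unitI s -> unitI t -> s <= t ->
  (g (u s) <= 0 <= g (u t)) || (g (u t) <= 0 <= g (u s)) ->
  exists2 z, s <= z <= t & u z = x.
Proof.
move=> Is It st hst.
(* The loop is continuous on the unit interval only; clamping the parameter yields a function
   continuous on the whole line. *)
pose clamp (r : R) := Num.max (Num.min (1 * r + 0) 1) 0.
have lclamp : lipschitz_by 1 clamp.
  apply: lipschitz_by_max; last exact: lipschitz_by_cst.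
  apply: lipschitz_by_min; last exact: lipschitz_by_cst.
  by rewrite -[X in lipschitz_by X](@normr1 R); exact: lipschitz_by_affine.
have Iclamp r : unitI (clamp r).
  apply/unitIP; rewrite /clamp.
  by case: (leP (1 * r + 0)) => ?; case: (leP _ 0) => ?; apply/andP; split; lra.
have clampE r : unitI r -> clamp r = r.
  move=> /unitIP /andP[? ?]; rewrite /clamp.
  by case: (leP (1 * r + 0)) => ?; case: (leP _ 0) => ?; lra.
pose h r := g (u (clamp r)).
have ch : continuous h.
  move=> r; apply/cvgrPdist_lt => e e0.
  have [del del0 hdel] := loop_cont u (Iclamp r) e0.
  near=> r'.
  apply: le_lt_trans (g_lip _ _) _; apply: hdel => //.
  apply: le_lt_trans (lclamp _ _) _; rewrite mul1r.
  by near: r'; exact: (nbhsx_ballx r del del0).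
have [z z_in hz] : exists2 z, z \in `[s, t] & h z = 0.
  apply: IVT => //; first exact: continuous_subspaceT.
  rewrite /h !clampE //.
  by case: (leP (g (u s)) (g (u t))) => ?; case/orP: hst => /andP[? ?]; apply/andP; split; lra.
move: z_in; rewrite in_itv /= => z_in; exists z => //.
rewrite -(clampE z); first exact: g_zero.
move: z_in Is It => /andP[? ?] /unitIP /andP[? ?] /unitIP /andP[? ?].
by apply/unitIP/andP; split; lra.
Unshelve. all: by end_near.
Qed.

(** The invariant of the sweep: [f] imitates [u] up to [c] and then rests at [x], so that a further
    excursion can be glued on at [c]. *)
Definition approximable (e c : R) := exists f : loop,
  [/\ splits f, (forall s, unitI s -> s <= c -> d (u s) (f s) < e) &
      (forall s, unitI s -> c <= s -> f s = x)].

(** Let c1 be the last visit of the base point in [c, a] and c2 the first one from a on. On [c, c1]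
    the constant loop is close enough to [u]; on [c1, c2] there is a single excursion, which stays
    in one part and is copied unchanged. *)
Lemma approximable_step e c a : 0 < e -> unitI c -> u c = x -> approximable e c ->
  unitI a -> c <= a -> (forall s, c <= s <= a -> d (u s) x < e) ->
  exists c', [/\ unitI c', u c' = x, a <= c' & approximable e c'].
Proof.
move=> e0 Ic uc [f [sf fu fx]] Ia ca near_x.
pose Z1 := [set z | c <= z <= a /\ u z = x].
pose Z2 := [set z | a <= z <= 1 /\ u z = x].
have /unitIP /andP[c_ge0 c_le1] := Ic.
have /unitIP /andP[a_ge0 a_le1] := Ia.
have Z1c : Z1 c by rewrite /Z1 /= lexx ca.
have Z21 : Z2 1 by rewrite /Z2 /= lexx a_le1 loop1.
have Z1I z : Z1 z -> unitI z /\ u z = x.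
  by move=> [/andP[? ?] ?]; split=> //; apply/unitIP/andP; split; lra.
have Z2I z : Z2 z -> unitI z /\ u z = x.
  by move=> [/andP[? ?] ?]; split=> //; apply/unitIP/andP; split; lra.
have [I1 u1] := base_sup (ex_intro _ c Z1c) Z1I.
have [I2 u2] := base_inf (ex_intro _ 1 Z21) Z2I.
have ub1 z : Z1 z -> z <= sup Z1.
  by move=> Zz; apply: ub_le_sup => //; exists a => w [/andP[]].
have lb2 z : Z2 z -> inf Z2 <= z.
  by move=> Zz; apply: ge_inf => //; exists a => w [/andP[]].
have c1a : sup Z1 <= a by apply: ge_sup => [|w [/andP[]]] //; exists c.
have ac2 : a <= inf Z2 by apply: lb_le_inf => [|w [/andP[]]] //; exists 1.
move: (sup Z1) (inf Z2) I1 u1 I2 u2 ub1 lb2 c1a ac2 => c1 c2 I1 u1 I2 u2 ub1 lb2 c1a ac2.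
have cc1 := ub1 _ Z1c.
have /unitIP /andP[c1_ge0 c1_le1] := I1.
have /unitIP /andP[c2_ge0 c2_le1] := I2.
have no_base z : c1 < z -> z < c2 -> u z <> x.
  move=> z1 z2 uz; case: (leP z a) => za.
    by have := ub1 z; rewrite /Z1 /= uz za => /(_ (conj _ erefl)); lra.
  by have := lb2 z; rewrite /Z2 /= uz (ltW za) => /(_ (conj _ erefl)); lra.
(* Freezing the parameter outside [c1, c2] isolates the excursion: the loop [v] rests at [x] before
   c1 and after c2. *)
pose clamp (s : R) := Num.max c1 (Num.min c2 (1 * s + 0)).
have clamp_bounds s : c1 <= clamp s <= c2.
  by rewrite /clamp le_max lexx ge_max ge_min lexx /= andbT; lra.
have Iclamp s : unitI (clamp s).
  by have /andP[? ?] := clamp_bounds s; apply/unitIP/andP; split; lra.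
have lclamp : lipschitz_by 1 clamp.
  apply: lipschitz_by_max; first exact: lipschitz_by_cst.
  apply: lipschitz_by_min; first exact: lipschitz_by_cst.
  by rewrite -[X in lipschitz_by X](@normr1 R); exact: lipschitz_by_affine.
have clampE s : c1 <= s <= c2 -> clamp s = s.
  by move=> /andP[? ?]; rewrite /clamp; case: (leP c2 (1 * s + 0)) => ?; case: (leP c1 _) => ?; lra.
have clamp_le s : s <= c1 -> clamp s = c1.
  by move=> ?; rewrite /clamp; case: (leP c2 (1 * s + 0)) => ?; case: (leP c1 _) => ?; lra.
have clamp_ge s : c2 <= s -> clamp s = c2.
  by move=> ?; rewrite /clamp; case: (leP c2 (1 * s + 0)) => ?; case: (leP c1 _) => ?; lra.
have v_loop : is_loop d x (u \o clamp).
  split; first exact: (cont_on_I_comp ler01 (loop_cont u) lclamp).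
  by rewrite /= clamp_le // clamp_ge.
pose v := Loop v_loop.
have sv : splits v.
  (* Values of [g] of both strict signs would force a visit of the base point strictly between c1
     and c2. *)
  case: (pselect (exists2 s, c1 <= s <= c2 & g (u s) < 0)) => [[s hs gs]|no_neg].
    apply: splits_right => t /=; apply: g_le0; rewrite leNgt; apply/negP => gt.
    have [t1 t2] := andP (clamp_bounds t); have [s1 s2] := andP hs.
    have Is : unitI s by apply/unitIP/andP; split; lra.
    have [z [z12 uz]] : exists z, c1 < z < c2 /\ u z = x.
      have sx : u s <> x by move=> e1; move: gs; rewrite e1 g_base ltxx.
      have tx : u (clamp t) <> x by move=> e1; move: gt; rewrite e1 g_base ltxx.
      have [s1' s2' t1' t2'] : [/\ c1 < s, s < c2, c1 < clamp t & clamp t < c2].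
        by split; rewrite lt_neqAle ?s1 ?s2 ?t1 ?t2 andbT; apply/eqP => h;
          [apply: sx; rewrite -h|apply: sx; rewrite h|apply: tx; rewrite -h|apply: tx; rewrite h].
      case: (leP s (clamp t)) => st.
        have [|z /andP[? ?] uz] := base_between Is (Iclamp t) st.
          by rewrite (ltW gs) (ltW gt).
        by exists z; split=> //; apply/andP; split; lra.
      have [|z /andP[? ?] uz] := base_between (Iclamp t) Is (ltW st).
        by rewrite (ltW gs) (ltW gt) orbT.
      by exists z; split=> //; apply/andP; split; lra.
    by move: z12 => /andP[z1 z2]; exact: (no_base z).
  apply: splits_left => t /=; apply: g_ge0; rewrite leNgt; apply/negP => gt.
  by apply: no_neg; exists (clamp t).
have vx s : unitI s -> s <= c -> v s = x.
  by move=> _ sc; rewrite /= clamp_le //; lra.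
have h_loop := is_loop_glue Ic fx vx.
exists c2; split=> //; exists (Loop h_loop); split.
- exact: (@splits_cat f v (Loop h_loop) (homotopic_glue Ic fx vx) sf sv).
- move=> s Is sc2; rewrite /= /glue; case: (leP s c) => sc; first exact: fu.
  rewrite /=; case: (leP s c1) => sc1.
    by rewrite clamp_le // u1; apply: near_x; apply/andP; split; lra.
  by rewrite clampE ?d_refl // (ltW sc1).
- move=> s Is c2s; rewrite /= /glue; case: (leP s c) => sc.
    by apply: fx => //; lra.
  by rewrite /= clamp_ge.
Qed.

(** The supremum of the visits reached by the sweep is itself a visit, so [u] stays near [x] around
    it, and one more step from a reached point just below would pass beyond it unless 1 is
    attained. *)
Lemma approximable_1 e : 0 < e -> approximable e 1.
Proof.
move=> e0; pose A := [set c | [/\ unitI c, u c = x & approximable e c]].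
have A0 : A 0.
  split; [exact: unitI0|exact: loop0|exists lone; split=> //].
    by apply: splits_left => s /=; rewrite rA_base rB_base.
  move=> s /unitIP /andP[s0 _] s0'; have -> : s = 0 by lra.
  by rewrite loop0 d_refl.
have AI c : A c -> unitI c /\ u c = x by case.
have [I1 u1] := base_sup (ex_intro _ 0 A0) AI.
have supA : has_sup A.
  by split; [exists 0|exists 1 => w [/unitIP /andP[]]].
have [del del0 hdel] := loop_cont u I1 e0.
have [c Ac hc] := sup_adherent del0 supA.
have [Ic uc appc] := Ac.
have cle : c <= sup A by apply: ub_le_sup => //; case: supA.
have /unitIP /andP[c0 c1] := Ic.
have /unitIP /andP[b0 b1] := I1.
(* Beyond the supremum but within [del] of it. Since the step gives a point of [A] at or after [a],
   the minimum must be 1. *)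
pose a := Num.min 1 (sup A + del / 2).
have [a1 a2 a3] : [/\ a <= 1, a <= sup A + del / 2 & a = 1 \/ a = sup A + del / 2].
  by rewrite /a; case: (leP 1 (sup A + del / 2)) => ?; (split; [lra|lra|]); [left|right].
have ba : sup A <= a by case: a3 => ->; lra.
have [|||c' [Ic' uc' ac' appc']] := approximable_step (a := a) e0 Ic uc appc.
- by apply/unitIP/andP; split; lra.
- lra.
- move=> s /andP[s1 s2]; have := hdel s; rewrite u1 d_sym; apply.
    by apply/unitIP/andP; split; lra.
  by rewrite ltr_norml; apply/andP; split; lra.
have c'A : c' <= sup A by apply: ub_le_sup; [case: supA|split].
have -> : 1 = c'; last by [].
have /unitIP /andP[? ?] := Ic'.
by case: a3 => ?; lra.
Qed.

Lemma rev_close (e : R) (l l' : R -> T) :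
  (forall s, unitI s -> d (l s) (l' s) < e) ->
  forall s, unitI s -> d (rev l s) (rev l' s) < e.
Proof. by move=> hl s Is; exact/hl/unitI_rev. Qed.

(* Infinitely many excursions may alternate between the two parts; closedness of [S]
   lets us replace [u] by nearby loops with finitely many excursions. *)
Lemma closed_subgroup_splitting : is_closed_loops d x S ->
  S (concat u (rev (concat (rA \o u) (rB \o u)))).
Proof.
move=> S_closed; apply: S_closed; first exact: loopP (lcat u (lrev (lcat (pA u) (pB u)))).
move=> e e0; have [d1 d10 h1] := rA_cont e0; have [d2 d20 h2] := rB_cont e0.
(* This accuracy keeps [f] and both of its parts within [e] of those of [u]. *)
have e'0 : 0 < Num.min e (Num.min d1 d2) by rewrite !lt_min e0 d10.
have [f [sf fu _]] := approximable_1 e'0.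
exists (lcat f (lrev (lcat (pA f) (pB f)))) => // s Is.
have close t : unitI t -> [/\ d (u t) (f t) < e, d (u t) (f t) < d1 & d (u t) (f t) < d2].
  move=> It; have /unitIP /andP[_ t1] := It.
  by have := fu t It t1; rewrite !lt_min => /andP[? /andP[? ?]].
apply: concat_close Is => [t It|]; first by have [] := close t It.
apply: rev_close => t It; apply: concat_close It => r Ir /=.
  by apply: h1; have [] := close r Ir.
by apply: h2; have [] := close r Ir.
Qed.

End Splitting.

(** * The shrinking wedge *)

Section ShrunkDist.
Variables (R : realType) (X : nat -> metricType R) (n : nat).
Implicit Types y z w : X n.

Lemma exp2V_gt0 (k : nat) : 0 < (2 : R) ^- k.
Proof. by rewrite invr_gt0 exprn_gt0. Qed.

Lemma shrunk_dist_ge0 y z : 0 <= shrunk_dist y z.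
Proof. by rewrite /shrunk_dist le_min mdist_ge0 ltW ?exp2V_gt0. Qed.

Lemma shrunk_dist_refl y : shrunk_dist y y = 0.
Proof. by rewrite /shrunk_dist mdistxx min_l // ltW ?exp2V_gt0. Qed.

Lemma shrunk_dist_sym y z : shrunk_dist y z = shrunk_dist z y.
Proof. by rewrite /shrunk_dist metric_sym. Qed.

Lemma shrunk_dist_triangle y z w : shrunk_dist y w <= shrunk_dist y z + shrunk_dist z w.
Proof.
have := shrunk_dist_ge0 y z; have := shrunk_dist_ge0 z w.
rewrite /shrunk_dist; have := metric_triangle y z w.
have := exp2V_gt0 n; set e := 2 ^- n => e0.
by case: (leP (mdist y z) e) => ?; case: (leP (mdist z w) e) => ?; case: (leP (mdist y w) e) => ?; lra.
Qed.

Lemma shrunk_dist_eq0 y z : shrunk_dist y z = 0 -> y = z.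
Proof.
rewrite /shrunk_dist; case: leP => _; first exact: mdist_positivity.
by move=> e0; have := exp2V_gt0 n; rewrite e0 ltxx.
Qed.

Lemma shrunk_dist_le y z : shrunk_dist y z <= 2 ^- n.
Proof. by rewrite /shrunk_dist ge_min lexx orbT. Qed.

Lemma shrunk_dist_le_mdist y z : shrunk_dist y z <= mdist y z.
Proof. by rewrite /shrunk_dist ge_min lexx. Qed.

End ShrunkDist.

(** * The wedge metric as a sum over components; retractions and inclusions *)

Section Wedge.
Variables (R : realType) (X : nat -> metricType R) (x : forall n, X n).

Local Notation W := (swedge x).
Local Notation dW := (@swedge_dist R X x).
Local Notation w0 := (swedge_base x).
Implicit Types (a b : W) (n k N M : nat) (Q : pred nat).

Definition wpt_component n (p : wpt X) : X n :=
  match @eqP nat (projT1 p) n with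
  | ReflectT e => eq_rect (projT1 p) X (projT2 p) n e
  | ReflectF _ => x n
  end.

Lemma wpt_component_id n (y : X n) : wpt_component n (existT _ n y) = y.
Proof.
by rewrite /wpt_component /=; case: eqP => // e; rewrite (eq_axiomK e).
Qed.

Lemma wpt_component_ne n (p : wpt X) : projT1 p <> n -> wpt_component n p = x n.
Proof. by rewrite /wpt_component; case: eqP. Qed.

(* At most two terms are nonzero, so that the upper bound [M] is immaterial. *)
Lemma wpt_distE M (p q : wpt X) : (projT1 p < M)%N -> (projT1 q < M)%N ->
  wpt_dist x p q = \sum_(k < M) shrunk_dist (wpt_component k p) (wpt_component k q).
Proof.
case: p q => n y [m z] /= nM mM.
case: eqP => [e|nm].
  case: m / e z mM => z mM /=.
  rewrite (bigD1 (Ordinal nM)) //= big1 ?addr0 ?wpt_component_id // => k kn.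
  have nk : n <> k by move=> e; move: kn; rewrite -val_eqE /= e eqxx.
  by rewrite !wpt_component_ne // shrunk_dist_refl.
have mn : Ordinal mM != Ordinal nM by rewrite -val_eqE /=; apply/eqP => e; apply: nm.
rewrite (bigD1 (Ordinal nM)) //= (bigD1 (Ordinal mM)) //= big1 ?addr0.
  by rewrite !wpt_component_id !wpt_component_ne //= => e; apply: nm.
move=> k /andP[kn km].
have nk : n <> k by move=> e; move: kn; rewrite -val_eqE /= e eqxx.
have mk : m <> k by move=> e; move: km; rewrite -val_eqE /= e eqxx.
by rewrite !wpt_component_ne // shrunk_dist_refl.
Qed.

(** The base point is represented by [x 0] and so has index 0. *)
Definition index_of a : nat := projT1 (swedge_proj a).
Definition component n a : X n := wpt_component n (swedge_proj a).

Lemma component_base n : component n w0 = x n.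
Proof.
rewrite /component /=; have [<-|n0] := pselect (0%N = n); first exact: wpt_component_id.
by rewrite wpt_component_ne.
Qed.

Lemma component_ne n a : index_of a <> n -> component n a = x n.
Proof. exact: wpt_component_ne. Qed.

Lemma swedge_distE M a b : (index_of a < M)%N -> (index_of b < M)%N ->
  dW a b = \sum_(k < M) shrunk_dist (component k a) (component k b).
Proof. exact: wpt_distE. Qed.

Lemma swedge_dist_refl a : dW a a = 0.
Proof.
rewrite (@swedge_distE (index_of a).+1) // big1 // => k _; exact: shrunk_dist_refl.
Qed.

Lemma swedge_dist_sym a b : dW a b = dW b a.
Proof.
pose M := (maxn (index_of a) (index_of b)).+1.
rewrite !(@swedge_distE M) ?ltnS ?leq_maxl ?leq_maxr //.
by apply: eq_bigr => k _; exact: shrunk_dist_sym.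
Qed.

Lemma swedge_dist_triangle a b c : dW a c <= dW a b + dW b c.
Proof.
pose M := (maxn (maxn (index_of a) (index_of b)) (index_of c)).+1.
have [aM bM cM] : [/\ index_of a < M, index_of b < M & index_of c < M]%N.
  by rewrite /M !ltnS !leq_max !leqnn ?orbT.
rewrite !(@swedge_distE M) // -big_split /=.
by apply: ler_sum => k _; exact: shrunk_dist_triangle.
Qed.

Lemma shrunk_dist_component n a b : shrunk_dist (component n a) (component n b) <= dW a b.
Proof.
pose M := (maxn (maxn (index_of a) (index_of b)) n).+1.
have [aM bM nM] : [/\ index_of a < M, index_of b < M & n < M]%N.
  by rewrite /M !ltnS !leq_max !leqnn ?orbT.
rewrite (@swedge_distE M) // (bigD1 (Ordinal nM)) //= lerDl.
by apply: sumr_ge0 => k _; exact: shrunk_dist_ge0.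
Qed.

Lemma swedge_dist_ge0 a b : 0 <= dW a b.
Proof. exact: le_trans (shrunk_dist_ge0 _ _) (shrunk_dist_component 0 a b). Qed.

(** A point of [X n] other than [x n] is told from points of the other summands by its component
    [n], which for those is [x n]. *)
Lemma component_inj a b : (forall n, component n a = component n b) -> a = b.
Proof.
case: a b => [[[n y] ny]|] [[[m z] mz]|] //= h.
- have nm : m = n.
    apply: (contra_notP _ ny) => nm; have := h n.
    by rewrite /component /= wpt_component_id wpt_component_ne.
  case: n / nm y ny h => y ny h.
  have := h m; rewrite /component /= !wpt_component_id => yz.
  by case: z / yz mz h => mz _; congr (Some _); congr exist; exact: Prop_irrelevance.
- by have := h n; rewrite component_base /component /= wpt_component_id.
- by have := h m; rewrite component_base /component /= wpt_component_id => /esym.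
Qed.

Lemma swedge_dist_eq0 a b : dW a b = 0 -> a = b.
Proof.
move=> ab0; apply: component_inj => n; apply/shrunk_dist_eq0/le_anti.
by rewrite shrunk_dist_ge0 andbT -ab0 shrunk_dist_component.
Qed.

Lemma swedge_dist_base_le a : dW a w0 <= 2 ^- index_of a.
Proof.
rewrite (@swedge_distE (index_of a).+1) // big_ord_recr /= big1 ?add0r.
  exact: shrunk_dist_le.
move=> k _; rewrite component_base component_ne ?shrunk_dist_refl // => e.
by have := ltn_ord k; rewrite -e ltnn.
Qed.

Definition retract Q a : W := if Q (index_of a) then a else w0.

Lemma retract_base Q : retract Q w0 = w0.
Proof. by rewrite /retract; case: ifP. Qed.

Lemma component_retract Q n a : component n (retract Q a) = if Q n then component n a else x n.
Proof.
rewrite /retract; have [<-|an] := pselect (index_of a = n).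
  by case: ifP => // _; exact: component_base.
by rewrite (component_ne an) if_same; case: ifP => // _; [exact: component_ne|exact: component_base].
Qed.

Lemma index_of_retract Q a : (index_of (retract Q a) <= index_of a)%N.
Proof. by rewrite /retract; case: ifP. Qed.

(** Each summand of the component sum belongs to exactly one of the two parts. This makes [retract]
    and [side] 1-Lipschitz. *)
Lemma swedge_dist_retract Q a b :
  dW (retract Q a) (retract Q b) + dW (retract (predC Q) a) (retract (predC Q) b) = dW a b.
Proof.
pose M := (maxn (index_of a) (index_of b)).+1.
have aM : (index_of a < M)%N by rewrite ltnS leq_maxl.
have bM : (index_of b < M)%N by rewrite ltnS leq_maxr.
have rM Q' c : (index_of c < M)%N -> (index_of (retract Q' c) < M)%N.
  exact: leq_ltn_trans (index_of_retract _ _).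
rewrite !(@swedge_distE M) ?rM // -big_split /=; apply: eq_bigr => k _.
by rewrite !component_retract /=; case: ifP; rewrite /= shrunk_dist_refl ?addr0 ?add0r.
Qed.

Lemma swedge_dist_retract_le Q a b : dW (retract Q a) (retract Q b) <= dW a b.
Proof. by rewrite -(swedge_dist_retract Q a b) lerDl swedge_dist_ge0. Qed.

Lemma retract_cont Q : uniformly_continuous dW dW (retract Q).
Proof.
by move=> e e0; exists e => // a b; apply: le_lt_trans; exact: swedge_dist_retract_le.
Qed.

Lemma component_cont n : uniformly_continuous dW (@mdist R (X n)) (component n).
Proof.
(* Below the cap [2 ^- n] the shrunk distance is the original one. *)
move=> e e0; exists (Num.min e (2 ^- n)); first by rewrite lt_min e0 exp2V_gt0.
move=> a b; rewrite lt_min => /andP[abe abn].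
have := shrunk_dist_component n a b; rewrite /shrunk_dist ge_min => /orP[|] h.
  exact: le_lt_trans abe.
by have := le_lt_trans h abn; rewrite ltxx.
Qed.

Definition inject n (y : X n) : W :=
  match pselect (y = x n) with
  | left _ => w0
  | right ne => Some (exist (fun p : wpt X => projT2 p <> x (projT1 p)) (existT _ n y) ne)
  end.

Lemma component_inject n (y : X n) : component n (inject y) = y.
Proof.
rewrite /inject; case: pselect => [->|ne]; first exact: component_base.
exact: wpt_component_id.
Qed.

Lemma component_inject_ne n k (y : X n) : n <> k -> component k (inject y) = x k.
Proof.
move=> nk; rewrite /inject; case: pselect => [_|ne]; first exact: component_base.
exact: wpt_component_ne.
Qed.

Lemma inject_base n : inject (x n) = w0.
Proof. by rewrite /inject; case: pselect. Qed.

Lemma inject_component n a : inject (component n a) = retract (pred1 n) a.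
Proof.
apply: component_inj => k; rewrite component_retract /=.
case: eqP => [->|kn]; first exact: component_inject.
by apply: component_inject_ne => e; apply: kn.
Qed.

Lemma index_of_inject n (y : X n) : (index_of (inject y) <= n)%N.
Proof. by rewrite /inject; case: pselect. Qed.

Lemma swedge_dist_inject n (y z : X n) : dW (inject y) (inject z) = shrunk_dist y z.
Proof.
rewrite (@swedge_distE n.+1) ?ltnS ?index_of_inject // big_ord_recr /= big1 ?add0r.
  by rewrite !component_inject.
move=> k _; rewrite !component_inject_ne ?shrunk_dist_refl // => e;
  by have := ltn_ord k; rewrite -e ltnn.
Qed.

Lemma inject_cont n : uniformly_continuous (@mdist R (X n)) dW (@inject n).
Proof.
move=> e e0; exists e => // y z; rewrite swedge_dist_inject; apply: le_lt_trans.
exact: shrunk_dist_le_mdist.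
Qed.

(** The distance to the base point, with sign plus on the summands in [Q] and minus on the
    others. *)
Definition side Q a : R := dW (retract Q a) w0 - dW (retract (predC Q) a) w0.

Lemma side_lip Q a b : `|side Q a - side Q b| <= dW a b.
Proof.
rewrite -(swedge_dist_retract Q a b) /side.
have h c c' : `|dW c w0 - dW c' w0| <= dW c c'.
  have := swedge_dist_triangle c c' w0; have := swedge_dist_triangle c' c w0.
  by rewrite (swedge_dist_sym c' c) ler_norml => ? ?; apply/andP; split; lra.
have := h (retract Q a) (retract Q b); have := h (retract (predC Q) a) (retract (predC Q) b).
by rewrite !ler_norml => /andP[? ?] /andP[? ?]; apply/andP; split; lra.
Qed.

Lemma side_base Q : side Q w0 = 0.
Proof. by rewrite /side !retract_base subrr. Qed.

Lemma side_ge0 Q a : 0 <= side Q a -> retract Q a = a /\ retract (predC Q) a = w0.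
Proof.
rewrite /side /retract /=; case: ifP => //= _.
rewrite swedge_dist_refl sub0r oppr_ge0 => a0.
have -> : a = w0 by apply/swedge_dist_eq0/le_anti; rewrite a0 swedge_dist_ge0.
by [].
Qed.

Lemma side_le0 Q a : side Q a <= 0 -> retract (predC Q) a = a /\ retract Q a = w0.
Proof.
rewrite /side /retract /=; case: ifP => //= _.
rewrite swedge_dist_refl subr0 => a0.
have -> : a = w0 by apply/swedge_dist_eq0/le_anti; rewrite a0 swedge_dist_ge0.
by [].
Qed.

Lemma exists_exp2V_lt (e : R) : 0 < e -> exists N, 2 ^- N < e.
Proof.
move=> e0; exists (Num.truncn e^-1).+1.
rewrite -[ltRHS]invrK ltf_pV2 ?posrE ?invr_gt0 ?exprn_gt0 //.
apply: lt_trans (truncnS_gt _) _.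
by rewrite -natrX ltr_nat ltn_expl.
Qed.

Lemma exp2V_le N n : (N <= n)%N -> (2 : R) ^- n <= 2 ^- N.
Proof.
by move=> Nn; rewrite lef_pV2 ?posrE ?exprn_gt0 // ler_weXn2l // ler1n.
Qed.

Lemma swedge_dist_initial N a : dW a (retract (fun k => (k < N)%N) a) <= 2 ^- N.
Proof.
rewrite /retract; case: ltnP => h; first by rewrite swedge_dist_refl ltW ?exp2V_gt0.
exact: le_trans (swedge_dist_base_le a) (exp2V_le h).
Qed.

(** Dropping all but finitely many summands moves every point by a uniformly small amount, and the
    remaining distance is a finite sum of component distances. *)
Lemma cont_on_I_component (f : R -> W) :
  (forall n, cont_on_I (@mdist R (X n)) (component n \o f)) -> cont_on_I dW f.
Proof.
move=> cf s Is e e0.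
have sum_small N : forall e', 0 < e' -> exists2 del : R, 0 < del & forall t, unitI t ->
    `|s - t| < del -> \sum_(k < N) shrunk_dist (component k (f s)) (component k (f t)) < e'.
  elim: N => [|N IH] e' e'0; first by exists 1 => // t _ _; rewrite big_ord0.
  have e'2 : 0 < e' / 2 by rewrite divr_gt0.
  have [d1 d10 h1] := IH _ e'2; have [d2 d20 h2] := cf N s Is _ e'2.
  exists (Num.min d1 d2); first by rewrite lt_min d10.
  move=> t It; rewrite lt_min => /andP[st1 st2]; rewrite big_ord_recr /= (splitr e').
  apply: ltrD; first exact: h1.
  exact: le_lt_trans (shrunk_dist_le_mdist _ _) (h2 _ It st2).
have e3 : 0 < e / 3 by rewrite divr_gt0.
have [N hN] := exists_exp2V_lt e3.
(* The number of summands kept must be positive: the collapsed points have index 0, which has to lie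
   below the bound. *)
have [del del0 hdel] := sum_small N.+1 _ e3; exists del => // t It st.
pose Q k := (k < N.+1)%N.
have small a : dW a (retract Q a) < e / 3.
  apply: le_lt_trans (swedge_dist_initial _ _) _.
  by apply: le_lt_trans hN; exact: exp2V_le.
have mid : dW (retract Q (f s)) (retract Q (f t)) < e / 3.
  have iN a : (index_of (retract Q a) < N.+1)%N by rewrite /retract; case: ifP.
  rewrite (@swedge_distE N.+1) //.
  have := hdel t It st; congr (_ < _); apply: eq_bigr => k _.
  by rewrite !component_retract /Q ltn_ord.
have := swedge_dist_triangle (f s) (retract Q (f s)) (f t).
have := swedge_dist_triangle (retract Q (f s)) (retract Q (f t)) (f t).
have := small (f s); have := small (f t); rewrite (swedge_dist_sym (f t)).
lra.
Qed.

(** Meant for families with at most one coordinate off the base point; for others the coordinate is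
    an arbitrary choice. *)
Definition assemble (c : forall n, X n) : W :=
  match pselect (exists n, c n <> x n) with
  | left h => inject (c (sval (cid h)))
  | right _ => w0
  end.

Lemma component_assemble (c : forall n, X n) n :
  (forall k m, c k <> x k -> c m <> x m -> k = m) -> component n (assemble c) = c n.
Proof.
move=> uniq_c; rewrite /assemble; case: pselect => [h|no].
  case: (cid h) => k ck /=; have [<-|kn] := pselect (k = n); first exact: component_inject.
  rewrite component_inject_ne //; apply: contra_notP kn => cn.
  by apply: uniq_c => // e; apply: cn.
by rewrite component_base; apply: contra_notP no => cn; exists n => e; apply: cn.
Qed.

End Wedge.

(** * Loops in the wedge and the loops formed by their components *)

Section WedgeLoops.
Variables (R : realType) (X : nat -> metricType R) (x : forall n, X n).

Local Notation W := (swedge x).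
Local Notation dW := (@swedge_dist R X x).
Local Notation w0 := (swedge_base x).
Local Notation dX n := (@mdist R (X n)).

Let dW_refl := @swedge_dist_refl R X x.

Lemma is_loop_component n l : is_loop dW w0 l -> is_loop (dX n) (x n) (component n \o l).
Proof. exact: (is_loop_push (component_cont x n) (component_base x n)). Qed.

Lemma is_loop_retract Q l : is_loop dW w0 l -> is_loop dW w0 (retract Q \o l).
Proof. exact: (is_loop_push (retract_cont x Q) (retract_base x Q)). Qed.

(** The truncation to the summands up to [N] is split at summand [N]. That part is the image under
    [inject] of a loop in the closed hull of [X N], and the other part is the previous
    truncation. *)
Lemma closed_hull_initial (S : set (R -> W)) l N :
  is_subgroup dW w0 S -> is_closed_loops dW w0 S ->
  (forall a b, is_loop dW w0 a -> is_loop dW w0 b -> S (commutator a b)) ->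
  is_loop dW w0 l ->
  (forall n, closed_hull (dX n) (x n) (commutator_subgroup (dX n) (x n)) (component n \o l)) ->
  S (retract (fun k => (k < N)%N) \o l).
Proof.
move=> S_subgroup S_closed S_comm ll hl; elim: N => [|N IH].
  rewrite (_ : _ \o l = cst_loop w0); first by case: S_subgroup.
  by apply/funext => s; rewrite /= /retract ltn0.
pose u := Loop (is_loop_retract (fun k => (k < N.+1)%N) ll).
have uN : retract (pred1 N) \o u = @inject R X x N \o (component N \o l).
  apply/funext => s /=; rewrite inject_component; apply: component_inj => k.
  by rewrite !component_retract /=; case: eqP => // ->; rewrite ltnSn.
have uN' : retract (predC (pred1 N)) \o u = retract (fun k => (k < N)%N) \o l.
  apply/funext => s /=; apply: component_inj => k.
  by rewrite !component_retract /= ltnS ltn_neqAle; case: eqP.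
have SN : S (retract (pred1 N) \o u).
  rewrite uN; have := closed_hull_push (@inject_cont R X x N) (inject_base x N)
    (dW_refl w0) (mdistxx _) (hl N).
  by move=> /closed_hull_commutatorP; exact.
have SN' : S (retract (predC (pred1 N)) \o u) by rewrite uN'.
have split_u := closed_subgroup_splitting dW_refl (@swedge_dist_sym R X x) S_subgroup S_comm
  (retract_cont x (pred1 N)) (retract_cont x (predC (pred1 N))) (retract_base x _) (retract_base x _)
  (@side_lip R X x (pred1 N)) (side_base x _) (@side_ge0 R X x _) (@side_le0 R X x _) u S_closed.
pose v := lcat (Loop (is_loop_retract (pred1 N) (loopP u)))
               (Loop (is_loop_retract (predC (pred1 N)) (loopP u))).
apply: (@inS_modS _ _ _ _ (dW_refl w0) S S_subgroup u v split_u).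
by case: S_subgroup => _ _ _ Sc _; exact: Sc.
Qed.

Lemma h_equiv_component l m : is_loop dW w0 l -> is_loop dW w0 m ->
  (h_equiv dW w0 l m <->
   forall n, h_equiv (dX n) (x n) (component n \o l) (component n \o m)).
Proof.
move=> ll lm; have lu := is_path_concat ll (is_path_rev lm).
split=> [hlm n|hlm].
  have := closed_hull_push (component_cont x n) (component_base x n)
    (mdistxx _) (dW_refl w0) hlm.
  by rewrite push_concat.
apply/closed_hull_commutatorP => S S_subgroup S_closed S_comm.
apply: (S_closed _ lu) => e /exists_exp2V_lt[N hN].
exists (retract (fun k => (k < N)%N) \o concat l (rev m)).
  apply: closed_hull_initial => // n; have := hlm n.
  by rewrite push_concat.
by move=> s _; apply: le_lt_trans hN; exact: swedge_dist_initial.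
Qed.

(* Affine from [0] at [1 - 2^-n] to [1] at [1 - 2^-(n+1)], constant elsewhere. *)
Definition slot (n : nat) (s : R) : R :=
  Num.max (Num.min (2 ^+ n.+1 * s + (2 - 2 ^+ n.+1)) 1) 0.

Lemma lipschitz_slot n : lipschitz_by (2 ^+ n.+1) (slot n).
Proof.
have e0 : 0 <= (2 : R) ^+ n.+1 by rewrite exprn_ge0.
apply: lipschitz_by_max; last exact: lipschitz_by_cst.
apply: lipschitz_by_min; last exact: lipschitz_by_cst.
by rewrite -[X in lipschitz_by X](ger0_norm e0); exact: lipschitz_by_affine.
Qed.

Lemma unitI_slot n s : unitI (slot n s).
Proof.
apply/unitIP; rewrite /slot le_max lexx orbT ge_max ler01 andbT.
by rewrite ge_min lexx orbT.
Qed.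

Lemma slot0 n : slot n 0 = 0.
Proof.
have : (2 : R) <= 2 ^+ n.+1 by rewrite exprS ler_peMr // exprn_ege1 // ler1n.
rewrite /slot; set e := 2 ^+ n.+1 => he.
by case: (leP (e * 0 + (2 - e)) 1) => ?; case: leP => ?; lra.
Qed.

Lemma slot1 n : slot n 1 = 1.
Proof.
rewrite /slot; set e := 2 ^+ n.+1.
by case: (leP (e * 1 + (2 - e)) 1) => ?; case: leP => ?; lra.
Qed.

(** The unclamped slot is [2 - 2 ^+ n.+1 * (1 - s)]. In terms of [1 - s], different slots differ by
    powers of 2. *)
Lemma slot_bounds n s : slot n s != 0 -> slot n s != 1 ->
  1 < 2 ^+ n.+1 * (1 - s) < 2.
Proof.
rewrite /slot; set e := 2 ^+ n.+1.
case: (leP (e * s + (2 - e)) 1) => h1; last by rewrite (max_l ler01) eqxx.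
case: (leP (e * s + (2 - e)) 0) => h2; first by rewrite eqxx.
move=> _ h; have h3 : e * s + (2 - e) < 1 by rewrite lt_neqAle h h1.
by apply/andP; split; lra.
Qed.

(** For n < m the second quantity is at least twice the first, hence exceeds 2. *)
Lemma slot_disjoint n m (s : R) : 1 < 2 ^+ n.+1 * (1 - s) < 2 -> 1 < 2 ^+ m.+1 * (1 - s) < 2 ->
  n = m.
Proof.
wlog: n m / (n <= m)%N.
  move=> hw; case/orP: (leq_total n m) => nm; first exact: hw.
  by move=> h1 h2; apply/esym/hw.
rewrite leq_eqVlt => /orP[/eqP //|nm] /andP[n1 n2] /andP[m1 m2].
have s1 : 0 < 1 - s.
  have e0 : 0 < (2 : R) ^+ n.+1 by rewrite exprn_gt0.
  by rewrite -(pmulr_rgt0 _ e0); lra.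
have : 2 * (2 ^+ n.+1 * (1 - s)) <= 2 ^+ m.+1 * (1 - s).
  by rewrite mulrA -exprS ler_wpM2r ?(ltW s1) // ler_weXn2l // ler1n.
move=> h; have : (1 : R) < 1 by lra.
by rewrite ltxx.
Qed.

(** At each time at most one slot is strictly between 0 and 1, so at most one coordinate is off the
    base point and the family assembles. The delicate time is 1, where infinitely many loops
    accumulate; each single component is continuous there. *)
Lemma wedge_loop_exists (k : forall n, R -> X n) :
  (forall n, is_loop (dX n) (x n) (k n)) ->
  exists2 l : R -> W, is_loop dW w0 l & forall n, component n \o l = k n \o slot n.
Proof.
move=> lk.
have k0 n : k n 0 = x n by have [_ []] := lk n.
have k1 n : k n 1 = x n by have [_ []] := lk n.
pose l s := assemble x (fun n => k n (slot n s)).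
have lE n : component n \o l = k n \o slot n.
  apply/funext => s /=; apply: component_assemble => i j ci cj.
  have b i' : k i' (slot i' s) <> x i' -> 1 < 2 ^+ i'.+1 * (1 - s) < 2.
    by move=> c; apply: slot_bounds; apply/eqP => e; apply: c; rewrite e.
  exact: (slot_disjoint (b i ci) (b j cj)).
exists l => //; split; last first.
  split; apply: (@component_inj R X x) => n; rewrite component_base.
    by have := congr1 (@^~ 0) (lE n); rewrite /= slot0 k0.
  by have := congr1 (@^~ 1) (lE n); rewrite /= slot1 k1.
apply: cont_on_I_component => n; rewrite lE.
have [ck _] := lk n.
apply: (cont_on_I_comp _ ck (lipschitz_slot n)); first by rewrite exprn_ge0.
by move=> s _; exact: unitI_slot.
Qed.

Lemma h_equiv_slot n (k : R -> X n) : is_loop (dX n) (x n) k ->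
  h_equiv (dX n) (x n) (k \o slot n) k.
Proof.
move=> lk; have [ck [k0 k1]] := lk.
have e1 : (1 : R) <= 2 ^+ n.+1 by rewrite exprn_ege1 // ler1n.
have hom : homotopic (dX n) (x n) (k \o slot n) (k \o id).
  apply: (@homotopic_reparam _ _ _ _ (2 ^+ n.+1)) => //.
  - exact: lipschitz_slot.
  - exact: lipschitz_by_weaken (@lipschitz_by_id R).
  - by move=> s _; exact: unitI_slot.
  - exact: slot0.
  - exact: slot1.
  - by rewrite slot0.
  - by rewrite slot1.
have lks : is_loop (dX n) (x n) (k \o slot n).
  split; last by rewrite /= slot0 slot1.
  apply: (cont_on_I_comp _ ck (lipschitz_slot n)); first exact: (le_trans ler01 e1).
  by move=> s _; exact: unitI_slot.
exact: (@lhom_h_equiv _ _ _ _ (mdistxx _) (Loop lks) (Loop lk)).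
Qed.

End WedgeLoops.

(** The quotient groups are not formed; the isomorphism is given on representatives. In the third
    clause the forward implication is well-definedness on classes and the backward one is
    injectivity. *)
Theorem theorem4p5 (R : realType) (X : nat -> metricType R) (x : forall n, X n)
  (hpc : forall n (a b : X n), exists f : R -> X n, is_path (@mdist R (X n)) a b f) :
  let W := swedge x in
  let dW := @swedge_dist R X x in
  let w0 := swedge_base x in
  exists Phi : (R -> W) -> forall n, R -> X n,
    [/\ (forall l, is_loop dW w0 l -> forall n, is_loop (@mdist R (X n)) (x n) (Phi l n)),
        (forall l m, is_loop dW w0 l -> is_loop dW w0 m -> forall n,
           h_equiv (@mdist R (X n)) (x n) (Phi (concat l m) n) (concat (Phi l n) (Phi m n))),
        (forall l m, is_loop dW w0 l -> is_loop dW w0 m ->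
           (h_equiv dW w0 l m <-> forall n, h_equiv (@mdist R (X n)) (x n) (Phi l n) (Phi m n))) &
        (forall k : forall n, R -> X n, (forall n, is_loop (@mdist R (X n)) (x n) (k n)) ->
           exists2 l, is_loop dW w0 l & forall n, h_equiv (@mdist R (X n)) (x n) (Phi l n) (k n))].
Proof.
move=> W dW w0; exists (fun l n => component n \o l); split.
- by move=> l ll n; exact: is_loop_component.
- move=> l m ll lm n; rewrite push_concat.
  have lc := is_path_concat (is_loop_component n ll) (is_loop_component n lm).
  exact: (h_equiv_refl (mdistxx _) (Loop lc)).
- by move=> l m; exact: h_equiv_component.
- move=> k lk; have [l ll lE] := wedge_loop_exists lk; exists l => // n.
  by rewrite lE; exact: h_equiv_slot.
Qed.
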